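(* Let $\mathbb{F}$ be any field. For integers $n \ge 1$ and $k \ge 1$, let $y_1,\dots,y_n$ be noncommuting variables and let \[ S^*_{n,k}(y_1,\dots,y_n)=\sum_{\substack{(i_1,\dots,i_k)\in[n]^k\\ i_1,\dots,i_k \text{ pairwise distinct}}} y_{i_1}y_{i_2}\cdots y_{i_k}\in \mathbb{F}\langle y_1,\dots,y_n\rangle \] (the noncommutative symmetrization of the elementary symmetric polynomial $S_{n,k}=\sum_{T\subseteq[n],|T|=k}\prod_{i\in T}x_i$, i.e. each multilinear word of length $k$ has coefficient $1$). Then: (1) the family $\{S^*_{n,k}\}_{n>0}$ has $\binom{n}{\downarrow k/2}$-explicit algebraic branching programs over $\mathbb{F}$; (2) for a $k\times n$ matrix $Y=(y_{i,j})_{1\le i\le k,1\le j\le n}$ of noncommuting variables, the noncommutative rectangular permanent family $\{\mathrm{rper}(Y)\}_{n>0}$, where $\mathrm{rper}(Y)=\sum_{\sigma\in I_{k,n}} y_{1,\sigma(1)}y_{2,\sigma(2)}\cdots y_{k,\sigma(k)}$ and $I_{k,n}$ is the set of injections $[k]\to[n]$, has $\binom{n}{\downarrow k/2}$-explicit algebraic branching programs.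
   Context: Notation: $\binom{n}{\downarrow r}=\sum_{0\le i\le r}\binom{n}{i}$. $O^*(q)$ denotes $q$ times factors polynomial in $n$ and $k$ (asymptotically smaller terms are suppressed). An algebraic branching program (ABP) is a directed acyclic graph with one source and one sink whose vertices are partitioned into layers $0,1,\dots,\ell$, with edges only from layer $i$ to layer $i+1$, source in layer $0$ and sink in layer $\ell$; each edge is labelled by a linear form in the variables; the ABP computes the sum over all source-to-sink paths of the product (in path order, for noncommuting variables) of the edge labels; its size is its number of nodes (edges). A family $\{f_n\}_{n>0}$ of degree-$k$ polynomials has $q(n,k)$-explicit upper bounds (here: explicit ABPs) if there is an algorithm running in time $O^*(q(n,k))$ which on input $\langle 0^n,k\rangle$ outputs an ABP of size $O^*(q(n,k))$ computing $f_n$. *)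

(* Defs.v *)
From HB Require Import structures.
From mathcomp Require Import all_boot all_order all_algebra.
From mathcomp Require Import finmap.
From mathcomp.multinomials Require Import monalg.

Set Implicit Arguments.
Unset Strict Implicit.
Unset Printing Implicit Defensive.

Import GRing.Theory.
Local Open Scope ring_scope.

(* The free algebra F<V>: the monoid algebra of the free monoid of words in V. *)
Notation ncpoly F V := {malg F[{fmonom V}]}.

Definition ncvar (F : fieldType) (V : choiceType) (v : V) : ncpoly F V :=
  << fmu v >>.

Definition sym_star (F : fieldType) (n k : nat) : ncpoly F 'I_n :=
  \sum_(t : k.-tuple 'I_n | uniq t) \prod_(i <- t) ncvar F i.

(* The product over 'I_k is taken in increasing order of i. *)
Definition rper (F : fieldType) (n k : nat) : ncpoly F ('I_k * 'I_n)%type :=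
  \sum_(s : {ffun 'I_k -> 'I_n} | injectiveb s)
    \prod_(i < k) ncvar F (i, s i).

(* A vertex is a pair (layer, name). *)
Definition vertex : Type := (nat * nat)%type.

(* [:: (c1, v1); ...; (cr, vr)] stands for c1 v1 + ... + cr vr. *)
Definition linform (F : fieldType) (V : choiceType) : Type := seq (F * V).

Definition linform_poly (F : fieldType) (V : choiceType) (l : linform F V) :
    ncpoly F V :=
  \sum_(m <- l) m.1 *: ncvar F m.2.

Record edge (F : fieldType) (V : choiceType) : Type := Edge {
  e_src : vertex;
  e_dst : vertex;
  e_lab : linform F V }.

Record abp (F : fieldType) (V : choiceType) : Type := ABP {
  abp_depth : nat;
  abp_source : vertex;
  abp_sink : vertex;
  abp_nodes : seq vertex;
  abp_edges : seq (edge F V) }.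

(* "One source and one sink" is meant graph-theoretically: the source is the
   only vertex of in-degree 0 and the sink the only one of out-degree 0. *)
Record abp_wf (F : fieldType) (V : choiceType) (B : abp F V) : Prop := {
  wf_nodes : uniq (abp_nodes B);
  wf_layers : all (fun v : vertex => v.1 <= abp_depth B)%N (abp_nodes B);
  wf_simple : uniq [seq (e_src e, e_dst e) | e <- abp_edges B];
  wf_edges : all (fun e => [&& e_src e \in abp_nodes B,
                               e_dst e \in abp_nodes B &
                               (e_dst e).1 == (e_src e).1.+1]) (abp_edges B);
  wf_source : (abp_source B \in abp_nodes B) /\ (abp_source B).1 = 0%N;
  wf_sink : (abp_sink B \in abp_nodes B) /\ (abp_sink B).1 = abp_depth B;
  wf_one_source : forall v : vertex, v \in abp_nodes B ->
    (v \notin [seq e_dst e | e <- abp_edges B]) = (v == abp_source B);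
  wf_one_sink : forall v : vertex, v \in abp_nodes B ->
    (v \notin [seq e_src e | e <- abp_edges B]) = (v == abp_sink B) }.

Fixpoint is_walk (F : fieldType) (V : choiceType)
    (u : vertex) (es : seq (edge F V)) (v : vertex) : bool :=
  if es is e :: es' then (e_src e == u) && is_walk (e_dst e) es' v else u == v.

(* Edges raise the layer by one, so every source-to-sink path has exactly
   abp_depth B edges; paths are given by the positions of their edges. *)
Definition abp_poly (F : fieldType) (V : choiceType) (B : abp F V) :
    ncpoly F V :=
  let E := tnth (in_tuple (abp_edges B)) in
  \sum_(p : (abp_depth B).-tuple 'I_(size (abp_edges B)) |
          is_walk (abp_source B) (map E p) (abp_sink B))
    \prod_(i <- p) linform_poly (e_lab (E i)).

Definition abp_size (F : fieldType) (V : choiceType) (B : abp F V) : nat :=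
  (size (abp_nodes B) + size (abp_edges B))%N.

Definition symb (F : Type) : Type := (nat + F)%type.

Definition nats (F : Type) (s : seq nat) : seq (symb F) := map inl s.

(* The tags 0, 1, 2 mark a node, an edge and a summand of an edge label; since
   the codes of the variables of one program have the same length, the encoding
   is uniquely decodable. *)
Definition enc_term (F : fieldType) (V : choiceType) (code : V -> seq nat)
    (m : F * V) : seq (symb F) :=
  inl 2%N :: inr m.1 :: nats F (code m.2).

Definition enc_edge (F : fieldType) (V : choiceType) (code : V -> seq nat)
    (e : edge F V) : seq (symb F) :=
  nats F [:: 1%N; (e_src e).1; (e_src e).2; (e_dst e).1; (e_dst e).2]
    ++ flatten (map (enc_term code) (e_lab e)).

Definition enc_abp (F : fieldType) (V : choiceType) (code : V -> seq nat)
    (B : abp F V) : seq (symb F) :=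
  nats F [:: abp_depth B; (abp_source B).1; (abp_source B).2;
             (abp_sink B).1; (abp_sink B).2]
    ++ nats F (flatten [seq [:: 0%N; v.1; v.2] | v <- abp_nodes B])
    ++ flatten (map (enc_edge code) (abp_edges B)).

(* The machine of Aho, Hopcroft and Ullman (The Design and Analysis of Computer
   Algorithms, ch. 1) with structured control flow, extended by a second memory
   that holds elements of F, whose arithmetic has unit cost. The only field
   constants of a program are 0 and 1, so a program does not depend on F. *)

Inductive loc : Type :=
  | Dir of nat
  | Ind of nat.

Inductive operand : Type :=
  | Imm of nat
  | Cell of loc.

Inductive foperand : Type :=
  | FZero
  | FOne
  | FCell of loc.

Inductive natop : Type := Add | Sub | Mul | Div.

Inductive fieldop : Type := FAdd | FSub | FMul | FDiv.

Inductive test : Type :=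
  | TLe of operand & operand
  | TFeq of foperand & foperand.

Inductive cmd : Type :=
  | Skip
  | Set_ of loc & natop & operand & operand
  | FSet of loc & fieldop & foperand & foperand
  | Write of operand
  | FWrite of foperand
  | Seq of cmd & cmd
  | If of test & cmd & cmd
  | While of test & cmd.

Record state (F : fieldType) : Type := State {
  mem : nat -> nat;
  fmem : nat -> F;
  out : seq (symb F) }.

Definition upd (T : Type) (f : nat -> T) (a : nat) (x : T) : nat -> T :=
  fun b => if b == a then x else f b.

Definition addr (F : fieldType) (s : state F) (l : loc) : nat :=
  match l with Dir i => i | Ind i => mem s i end.

Definition eval (F : fieldType) (s : state F) (o : operand) : nat :=
  match o with Imm c => c | Cell l => mem s (addr s l) end.

Definition feval (F : fieldType) (s : state F) (o : foperand) : F :=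
  match o with FZero => 0 | FOne => 1 | FCell l => fmem s (addr s l) end.

(* Sub is truncated, and division by zero yields zero. *)
Definition eval_natop (o : natop) (a b : nat) : nat :=
  match o with
  | Add => (a + b)%N
  | Sub => (a - b)%N
  | Mul => (a * b)%N
  | Div => (a %/ b)%N
  end.

Definition eval_fieldop (F : fieldType) (o : fieldop) (a b : F) : F :=
  match o with
  | FAdd => a + b
  | FSub => a - b
  | FMul => a * b
  | FDiv => a / b
  end.

Definition eval_test (F : fieldType) (s : state F) (b : test) : bool :=
  match b with
  | TLe x y => (eval s x <= eval s y)%N
  | TFeq x y => feval s x == feval s y
  end.

(* The number of binary digits of a, with bitlen 0 = 1. *)
Definition bitlen (a : nat) : nat := (trunc_log 2 a).+1.

Definition cost_loc (F : fieldType) (s : state F) (l : loc) : nat :=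
  match l with Dir i => bitlen i | Ind i => (bitlen i + bitlen (mem s i))%N end.

Definition cost_op (F : fieldType) (s : state F) (o : operand) : nat :=
  match o with
  | Imm c => bitlen c
  | Cell l => (cost_loc s l + bitlen (mem s (addr s l)))%N
  end.

Definition cost_fop (F : fieldType) (s : state F) (o : foperand) : nat :=
  match o with FCell l => (cost_loc s l).+1 | _ => 1%N end.

Definition cost_test (F : fieldType) (s : state F) (b : test) : nat :=
  match b with
  | TLe x y => (cost_op s x + cost_op s y)%N
  | TFeq x y => (cost_fop s x + cost_fop s y)%N
  end.

(* exec c s t s': started in state s, c halts in state s' after time t. *)
Inductive exec (F : fieldType) : cmd -> state F -> nat -> state F -> Prop :=
  | exec_skip s : exec Skip s 1 s
  | exec_set s l o x y :
      exec (Set_ l o x y) s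
        (cost_loc s l + cost_op s x + cost_op s y)
        (State (upd (mem s) (addr s l) (eval_natop o (eval s x) (eval s y)))
               (fmem s) (out s))
  | exec_fset s l o x y :
      exec (FSet l o x y) s
        (cost_loc s l + cost_fop s x + cost_fop s y)
        (State (mem s)
               (upd (fmem s) (addr s l)
                    (eval_fieldop o (feval s x) (feval s y)))
               (out s))
  | exec_write s x :
      exec (Write x) s (cost_op s x)
        (State (mem s) (fmem s) (rcons (out s) (inl (eval s x))))
  | exec_fwrite s x :
      exec (FWrite x) s (cost_fop s x)
        (State (mem s) (fmem s) (rcons (out s) (inr (feval s x))))
  | exec_seq c1 c2 s1 s2 s3 t1 t2 :
      exec c1 s1 t1 s2 -> exec c2 s2 t2 s3 ->
      exec (Seq c1 c2) s1 (t1 + t2) s3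
  | exec_if b c1 c2 s s' t :
      exec (if eval_test s b then c1 else c2) s t s' ->
      exec (If b c1 c2) s (cost_test s b + t) s'
  | exec_while_true b c s1 s2 s3 t1 t2 :
      eval_test s1 b -> exec c s1 t1 s2 -> exec (While b c) s2 t2 s3 ->
      exec (While b c) s1 (cost_test s1 b + t1 + t2) s3
  | exec_while_false b c s :
      ~~ eval_test s b -> exec (While b c) s (cost_test s b) s.

(* Initially cells 0 and 1 hold n and k. All time bounds below allow factors
   polynomial in n, so it does not matter that n is not given in unary. *)
Definition init (F : fieldType) (n k : nat) : state F :=
  State (fun i => nth 0%N [:: n; k] i) (fun _ => 0) [::].

Definition binom_down (n r : nat) : nat := (\sum_(0 <= i < r.+1) 'C(n, i))%N.

(* f = O^*(q): f is at most q times a polynomial in n and k. *)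
Definition Ostar (q f : nat -> nat -> nat) : Prop :=
  exists c : nat, forall n k : nat, (0 < n)%N -> (0 < k)%N ->
    (f n k <= c * (n + k) ^ c * q n k)%N.

Definition explicit_ABPs (F : fieldType) (V : nat -> nat -> choiceType)
    (code : forall n k, V n k -> seq nat)
    (f : forall n k, ncpoly F (V n k)) (q : nat -> nat -> nat) : Prop :=
  exists (prog : cmd) (time size : nat -> nat -> nat),
    [/\ Ostar q time, Ostar q size &
        forall n k : nat, (0 < n)%N -> (0 < k)%N ->
          exists (B : abp F (V n k)) (t : nat) (s : state F),
            [/\ exec prog (init F n k) t s /\ (t <= time n k)%N,
                out s = enc_abp (@code n k) B,
                abp_wf B,
                (abp_size B <= size n k)%N &
                abp_poly B = f n k]].

Definition code_vec (n k : nat) (v : 'I_n) : seq nat := [:: v : nat].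

Definition code_mat (n k : nat) (v : 'I_k * 'I_n) : seq nat :=
  [:: v.1 : nat; v.2 : nat].

(* Main.v *)
(* Each node (j, C) of the branching program consists of a layer j and a subset C
   of [n] with |C| <= min(j, k - j). Reading y_i either keeps C, with coefficient
   1 if i is not in C and -1 otherwise, or flips the membership of i in C, with
   coefficient 1 if i enters C and -1 if it leaves. Let g_t(C) be the sum of all
   words of length t with distinct letters that use every letter of C. Splitting
   off the first letter i and writing the condition that i does not recur as a
   difference gives
     g_{t+1}(C) = sum_{i notin C} y_i (g_t(C) - g_t(C + i))
                + sum_{i in C} y_i (g_t(C - i) - g_t(C)),
   so the paths from (j, C) to the sink sum to (-1)^|C| g_{k-j}(C); the bound on
   |C| loses nothing because g_t(C) = 0 for |C| > t. At the source this is the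
   sum of all words of length k with distinct letters. Letting the variables
   depend on the layer gives the rectangular permanent.

   A set C is named sum_{i in C} (2^i + 2^n), from which both its size and its
   elements can be read off by divisions. The machine lists the names of all
   subsets of size at most k/2 by adding one element of [n] at a time, and then
   prints nodes and edges in nested loops over this list. *)
Require Import Defs.
From mathcomp Require Import all_boot all_order all_algebra.
From mathcomp Require Import zify.
From mathcomp.multinomials Require Import monalg.

Set Implicit Arguments.
Unset Strict Implicit.
Unset Printing Implicit Defensive.

Import Defs GRing.Theory.

(** * Preliminaries on tuples and subsets *)

Lemma big_tuple_cons (R : nmodType) (T : finType) m (P : pred (seq T))
    (f : seq T -> R) :
  (\sum_(t : m.+1.-tuple T | P t) f t =
   \sum_(x : T) \sum_(t : m.-tuple T | P (x :: t)) f (x :: t))%R.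
Proof.
rewrite pair_big_dep /=.
rewrite (reindex (fun xt : T * m.-tuple T => [tuple of xt.1 :: xt.2])) //=.
exists (fun t : m.+1.-tuple T => (thead t, [tuple of behead t])) => [[x t] _|t _] /=.
  by rewrite theadE; congr (_, _); apply: val_inj.
by rewrite [RHS]tuple_eta; apply: val_inj.
Qed.

Lemma subset_setU1 (T : finType) (x : T) (A : {set T}) (w : seq T) :
  (x |: A \subset w) = (x \in w) && (A \subset w).
Proof.
apply/subsetP/andP => [sub|[xw /subsetP sub] y].
  by split; [apply: sub|apply/subsetP => y yA; apply: sub];
    rewrite !inE ?eqxx ?yA ?orbT.
by rewrite !inE => /orP[/eqP->|/sub].
Qed.

(** * Path sums in a list of edges *)

Section WalkSums.

Local Open Scope ring_scope.

Variables (F : fieldType) (V : choiceType).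

(** Generalises [abp_poly] to arbitrary end vertices and lengths, so that the first edge can be
    split off. *)
Definition walk_sum (E : seq (edge F V)) m (u v : vertex) : ncpoly F V :=
  \sum_(p : m.-tuple 'I_(size E) | is_walk u (map (tnth (in_tuple E)) p) v)
    \prod_(i <- p) linform_poly (e_lab (tnth (in_tuple E) i)).

Lemma abp_polyE (B : abp F V) :
  abp_poly B =
    walk_sum (abp_edges B) (abp_depth B) (abp_source B) (abp_sink B).
Proof. by []. Qed.

Lemma walk_sum0 E u v : walk_sum E 0 u v = (u == v)%:R.
Proof.
rewrite /walk_sum big_mkcond (bigD1 [tuple]) //= big_nil big1 => [|p].
  by rewrite addr0; case: eqP.
by rewrite (tuple0 p); case/eqP.
Qed.

Lemma walk_sumS E m u v :
  walk_sum E m.+1 u v =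
    \sum_(e <- E | e_src e == u)
      linform_poly (e_lab e) * walk_sum E m (e_dst e) v.
Proof.
rewrite /walk_sum (big_tuple_cons _ (fun p => is_walk u (map (tnth (in_tuple E)) p) v)
  (fun p => \prod_(i <- p) linform_poly (e_lab (tnth (in_tuple E) i)))).
rewrite [RHS]big_tnth [RHS]big_mkcond /=; apply: eq_bigr => i _.
case: eqP => _ /=; last by rewrite big_pred0.
by rewrite big_distrr /=; apply: eq_bigr => p _; rewrite big_cons.
Qed.

End WalkSums.

(** * The sums g_t(C) over words with distinct letters *)

Section CoveringWords.

Local Open Scope ring_scope.

Variables (F : fieldType) (V : choiceType) (n : nat) (var : nat -> 'I_n -> V).

(** The index [j] is the layer at which the word starts; passing it along lets the variable depend
    on the position, as the permanent requires. *)
Fixpoint word_mon (j : nat) (w : seq 'I_n) : ncpoly F V :=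
  if w is i :: w' then ncvar F (var j i) * word_mon j.+1 w' else 1.

Definition cover_sum (j t : nat) (C : {set 'I_n}) : ncpoly F V :=
  \sum_(w : t.-tuple 'I_n | uniq w && (C \subset val w)) word_mon j w.

Lemma cover_sum0 j : cover_sum j 0 set0 = 1.
Proof.
rewrite /cover_sum (bigD1 [tuple]) /=; last by apply/subsetP => x; rewrite inE.
rewrite big1 ?addr0 // => p.
by rewrite (tuple0 p) => /andP[_ /eqP].
Qed.

Lemma cover_sum_big j t (C : {set 'I_n}) : (t < #|C|)%N -> cover_sum j t C = 0.
Proof.
move=> ltC; rewrite /cover_sum big_pred0 // => w;
  apply/negP=> /andP[_ /subset_leq_card].
by move/leq_trans => /(_ _ (card_size _)); rewrite size_tuple leqNgt ltC.
Qed.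

(** Among the words covering [C], those that contain [i] are exactly those covering [i |: C], so
    they cancel. *)
Lemma cover_sumB j t (C : {set 'I_n}) i :
  cover_sum j t C - cover_sum j t (i |: C) =
  \sum_(w : t.-tuple 'I_n | [&& i \notin val w, uniq w & C \subset val w])
    word_mon j w.
Proof.
rewrite /cover_sum (bigID (fun w : t.-tuple 'I_n => i \in val w)) /=.
rewrite addrC -addrA.
set X := \sum_(_ | _ && (_ \in _)) _;
  set Y := \sum_(_ | _ && (_ :|: _ \subset _)) _.
have -> : X = Y.
  apply: eq_bigl => w.
  by rewrite subset_setU1 -andbA; congr (_ && _); rewrite andbC.
by rewrite subrr addr0; apply: eq_bigl => w; rewrite andbC.
Qed.

Lemma cover_sumS j t (C : {set 'I_n}) :
  cover_sum j t.+1 C =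
  \sum_i ncvar F (var j i) *
    (if i \in C then cover_sum j.+1 t (C :\ i) - cover_sum j.+1 t C
     else cover_sum j.+1 t C - cover_sum j.+1 t (i |: C)).
Proof.
rewrite /cover_sum (big_tuple_cons _ (fun w => uniq w && (C \subset w)) (word_mon j)).
apply: eq_bigr => i _; rewrite -/(cover_sum _ _ _).
rewrite -/(cover_sum j.+1 t C) -/(cover_sum j.+1 t (i |: C)) -/(cover_sum j.+1 t (C :\ i)).
rewrite -big_distrr /=; congr (_ * _).
(* Once the first letter is [i], the rest has to cover only [C :\ i]. *)
have subE (w : seq 'I_n) : (C \subset i :: w) = (C :\ i \subset w).
  apply/subsetP/subsetP => [sub x|sub x xC].
    by rewrite !inE => /andP[nxi /sub]; rewrite inE (negbTE nxi).
  by rewrite inE; case: eqP => //= /eqP nxi; apply: sub; rewrite !inE nxi.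
case: ifP => iC.
  have := cover_sumB j.+1 t (C :\ i) i; rewrite setD1K // => ->;
    apply: eq_bigl => w.
  by rewrite subE -andbA.
rewrite cover_sumB; apply: eq_bigl => w; rewrite subE -andbA.
by rewrite (setDidPl _) // disjoint_sym disjoints1 iC.
Qed.

End CoveringWords.

(** * Numerical names of subsets and the list of small subsets *)

Section SubsetNames.

Variable n : nat.
Implicit Type C : {set 'I_n}.

Definition set_name C : nat := \sum_(i in C) (2 ^ i + 2 ^ n).

Lemma sum_pow2_lt (P : pred 'I_n) m :
  (forall i, P i -> i < m) -> \sum_(i < n | P i) 2 ^ i < 2 ^ m.
Proof.
move=> Pm; elim: m P Pm => [|m IH] P Pm; first by rewrite big_pred0 // => i;
  apply/negP=> /Pm.
rewrite (bigID (fun i : 'I_n => i < m)) /=.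
have h1 : \sum_(i < n | P i && (i < m)) 2 ^ i < 2 ^ m by apply: IH => i /andP[].
suff : \sum_(i < n | P i && ~~ (i < m)) 2 ^ i <= 2 ^ m.
  by move=> h2; rewrite expnS mul2n -addnn -addSn leq_add.
have [mn|nm] := ltnP m n; last first.
  by rewrite big_pred0 // => i; apply/negP => /andP[_]; have := ltn_ord i; lia.
have <- : \sum_(i < n | i == Ordinal mn) 2 ^ i = 2 ^ m by rewrite big_pred1_eq.
rewrite big_mkcond [leqRHS]big_mkcond; apply: leq_sum => i _.
case: ifP => // /andP[/Pm im nim]; case: ifP => // /eqP; case.
by apply: val_inj => /=; lia.
Qed.

Lemma set_nameE C : set_name C = #|C| * 2 ^ n + \sum_(i in C) 2 ^ i.
Proof. by rewrite /set_name big_split /= sum_nat_const addnC. Qed.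

(** The membership bits add up to less than [2 ^ n] and vanish in the quotient. *)
Lemma set_name_div C : set_name C %/ 2 ^ n = #|C|.
Proof.
by rewrite set_nameE divnMDl ?expn_gt0 // divn_small ?addn0 // sum_pow2_lt.
Qed.

(** The elements below [i] add less than [2 ^ i]. Those above [i], and [#|C| * 2 ^ n] because
    [i < n], add multiples of [2 ^ i.+1], so [i] alone decides the parity of the quotient. *)
Lemma set_name_bit C (i : 'I_n) : odd (set_name C %/ 2 ^ i) = (i \in C).
Proof.
rewrite set_nameE (bigID (fun j : 'I_n => j < i)) /=.
set a := \sum_(_ | _ && (_ < _)) _.
have alt : a < 2 ^ i by apply: sum_pow2_lt => j /andP[].
have [b bE] : exists b, \sum_(j in C | ~~ (j < i)) 2 ^ j = (i \in C) * 2 ^ i + b * 2 ^ i.+1.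
  exists (\sum_(j in C | i < j) 2 ^ (j - i.+1)).
  rewrite big_distrl /= (bigID (pred1 i)) /=; congr (_ + _).
    case: (boolP (i \in C)) => iC.
      by rewrite (big_pred1 i) ?mul1n // => j; rewrite /=; case: eqP => [->|];
        rewrite ?iC ?ltnn ?andbF.
    by rewrite big_pred0 // => j; rewrite /=; case: eqP => [->|];
      rewrite ?(negbTE iC) ?andbF.
  apply: eq_big => [j|j /andP[/andP[jC ji] nij]].
    by rewrite -leqNgt -andbA; congr (_ && _); rewrite ltn_neqAle eq_sym andbC.
  by rewrite -expnD subnK //; move: nij ji;
    rewrite -leqNgt ltn_neqAle -val_eqE /= => *; lia.
rewrite bE (_ : _ + _ = (#|C| * 2 ^ (n - i.+1) * 2 + b * 2 + (i \in C)) * 2 ^ i + a); last first.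
  have -> : 2 ^ n = 2 ^ (n - i.+1) * 2 * 2 ^ i by rewrite -mulnA -expnS -expnD subnK.
  rewrite expnS; move: #|C| (2 ^ _) (2 ^ i) (nat_of_bool _) a {bE alt} => c p q x a; lia.
by rewrite divnMDl ?expn_gt0 // divn_small // addn0 !oddD !oddM !andbF /=;
  case: (i \in C).
Qed.

Lemma set_name_inj : injective set_name.
Proof. by move=> C D eqCD; apply/setP => i; rewrite -!set_name_bit eqCD. Qed.

Lemma set_name0 : set_name set0 = 0.
Proof. by rewrite /set_name big_set0. Qed.

Lemma set_nameU1 C i : i \notin C -> set_name (i |: C) = set_name C + 2 ^ n + 2 ^ i.
Proof. by move=> iC; rewrite /set_name big_setU1 //=; lia. Qed.

Lemma set_nameD1 C i : i \in C -> set_name (C :\ i) = set_name C - 2 ^ n - 2 ^ i.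
Proof. by move=> iC; rewrite -{2}(setD1K iC) set_nameU1 ?setD11 //; lia. Qed.

Lemma set_name_lt C : set_name C < 2 ^ (n + n).
Proof.
have lt : \sum_(i in C) 2 ^ i < 2 ^ n by apply: sum_pow2_lt.
have cC : #|C| < 2 ^ n.
  by apply: leq_ltn_trans (ltn_expl n _) => //;
    rewrite -[n in leqRHS]card_ord max_card.
rewrite set_nameE expnD; apply: leq_trans (leq_mul cC (leqnn _)); lia.
Qed.

Variable r : nat.

(** The new sets go to the end because the machine pushes their names at the end of its array. *)
Definition grow (L : seq {set 'I_n}) (i : 'I_n) : seq {set 'I_n} :=
  L ++ [seq i |: C | C <- L & #|C| < r].

Definition small_subsets m : seq {set 'I_n} :=
  foldl grow [:: set0] (take m (enum 'I_n)).

Lemma small_subsetsS (i : 'I_n) :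
  small_subsets i.+1 = grow (small_subsets i) i.
Proof.
rewrite /small_subsets (take_nth i) ?size_enum_ord // nth_ord_enum.
by rewrite -cats1 foldl_cat.
Qed.

Lemma mem_small_subsets m C : m <= n ->
  (C \in small_subsets m) = [forall i in C, i < m] && (#|C| <= r).
Proof.
elim: m C => [|m IH] C mn.
  rewrite /small_subsets take0 inE; apply/eqP/idP => [->|/andP[/forall_inP h _]].
    by rewrite cards0 andbT; apply/forall_inP => i; rewrite inE.
  by apply/setP => i; rewrite inE; apply/negP => /h.
rewrite (small_subsetsS (Ordinal mn)) mem_cat IH ?(ltnW mn) //.
set i := Ordinal mn.
apply/orP/idP => [[/andP[/forall_inP lt cr]|/mapP[D]]|/andP[/forall_inP lt cr]].
- by rewrite cr andbT; apply/forall_inP => j /lt; lia.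
- rewrite mem_filter IH ?(ltnW mn) // => /and3P[Dr /forall_inP lt _] ->.
  rewrite cardsU1; apply/andP; split; last by case: (i \notin D); lia.
  by apply/forall_inP => j; rewrite !inE => /orP[/eqP->|/lt] //=; lia.
- have ltm j : j \in C -> j != i -> j < m.
    by move=> /lt; rewrite -val_eqE /=; lia.
  case: (boolP (i \in C)) => iC; [right|left].
    (* A set with the new element arises from [C :\ i], which is already listed and has fewer than
       [r] elements. *)
    apply/mapP; exists (C :\ i); last by rewrite setD1K.
    have cD : #|C :\ i| < r by move: cr; rewrite (cardsD1 i) iC.
    rewrite mem_filter IH ?(ltnW mn) //; rewrite cD (ltnW cD) andbT.
    by apply/forall_inP => j; rewrite !inE => /andP[ji jC]; apply: ltm.
  rewrite cr andbT; apply/forall_inP => j jC; apply: ltm => //.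
  by apply: contraNneq iC => <-.
Qed.

Lemma small_subsets_uniq m : m <= n -> uniq (small_subsets m).
Proof.
elim: m => [|m IH] mn; first by rewrite /small_subsets take0.
rewrite (small_subsetsS (Ordinal mn)) /grow cat_uniq IH ?(ltnW mn) //=.
set i := Ordinal mn.
(* No set contains [i] before its own round, so the new sets differ from the old ones and from each
   other. *)
have iN C : C \in small_subsets m -> i \notin C.
  rewrite (mem_small_subsets _ (ltnW mn)) => /andP[/forall_inP lt _].
  by apply/negP => /lt /=; rewrite ltnn.
apply/andP; split.
  apply/hasPn => _ /mapP[D _ ->]; apply/negP => /iN; by rewrite setU11.
rewrite map_inj_in_uniq ?filter_uniq ?IH ?(ltnW mn) // => C D.
rewrite !mem_filter => /andP[_ /iN iC] /andP[_ /iN iD] eqCD.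
by rewrite -(setU1K iC) eqCD setU1K.
Qed.

Lemma mem_small_subsetsT C : (C \in small_subsets n) = (#|C| <= r).
Proof.
by rewrite mem_small_subsets // andb_idl // => _; apply/forall_inP => i _.
Qed.

(** Sorting the subsets by cardinal gives one binomial coefficient for each size up to [r]. *)
Lemma size_small_subsets : size (small_subsets n) = binom_down n r.
Proof.
rewrite -(card_uniqP (small_subsets_uniq (leqnn n))).
rewrite (eq_card (B := [set C : {set 'I_n} | #|C| <= r])); last first.
  by move=> C; rewrite mem_small_subsetsT inE.
rewrite /binom_down big_mkord -sum1_card.
rewrite (partition_big (fun C : {set 'I_n} => (inord #|C| : 'I_r.+1)) predT) //=.
apply: eq_bigr => i _; rewrite sum1_card -[n in 'C(n, _)]card_ord -card_draws.
apply: eq_card => C; rewrite inE unfold_in !inE.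
apply/andP/eqP => [[Cr /eqP <-]|Ci]; first by rewrite inordK.
have Cr : #|C| <= r by have := ltn_ord i; rewrite -Ci.
by split => //; apply/eqP/val_inj; rewrite /= inordK.
Qed.

(** A crude bound that keeps the array addresses within the word size at every stage of the
    enumeration. *)
Lemma size_small_subsets_le m : m <= n -> size (small_subsets m) <= 2 ^ n.
Proof.
move=> mn; rewrite -[n in leqRHS]card_ord -cardsT -card_powerset.
rewrite -(card_uniqP (small_subsets_uniq mn)); apply: subset_leq_card.
by apply/subsetP => C _; rewrite powersetT inE.
Qed.

End SubsetNames.

(* Simplification unfolds [Finite.sort] in some occurrences of a cardinal but
   not in others, and [lia] compares atoms syntactically. *)
Local Ltac slia := simpl in *; lia.

(** * The branching program: well-formedness, size and polynomial *)

Section FlipProgram.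

Variables (F : fieldType) (V : choiceType) (n k : nat) (var : nat -> 'I_n -> V).
Implicit Types (C : {set 'I_n}) (o : option 'I_n) (x : nat * {set 'I_n}).

Definition flip C o : {set 'I_n} :=
  if o is Some i then if i \in C then C :\ i else i |: C else C.

Definition coef C (i : 'I_n) : F := (if i \in C then -1 else 1)%R.

(** The letters that keep [C] share one edge labelled by a sum, because [wf_simple] excludes
    parallel edges. *)
Definition label x o : linform F V :=
  if o is Some i then [:: (coef x.2 i, var x.1 i)]
  else [seq (coef x.2 i, var x.1 i) | i <- enum 'I_n].

Definition layer_sets j : seq {set 'I_n} :=
  [seq C : {set 'I_n} <- small_subsets n (k %/ 2) n | (#|C| <= j) && (#|C| + j <= k)].

Definition cells m : seq (nat * {set 'I_n}) :=
  [seq (j, C) | j <- iota 0 m, C <- layer_sets j].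

(** Only the bound by the remaining length is tested. The bound by the layer survives every move,
    since a flip changes the cardinal by at most one. *)
Definition moves x : seq (option 'I_n) :=
  [seq o <- None :: map some (enum 'I_n) | #|flip x.2 o| + x.1.+1 <= k].

Definition vtx x : vertex := (x.1, set_name x.2).

Definition move_edge x o : edge F V :=
  Edge (vtx x) (vtx (x.1.+1, flip x.2 o)) (label x o).

Definition flip_abp : abp F V := {|
  abp_depth := k;
  abp_source := (0, 0);
  abp_sink := (k, 0);
  abp_nodes := map vtx (cells k.+1);
  abp_edges := [seq move_edge x o | x <- cells k, o <- moves x] |}.

(** Adding the two bounds gives [2 * #|C| <= k], so the list of sets of size at most [k %/ 2] misses
    nothing. *)
Lemma mem_layer_sets j C :
  (C \in layer_sets j) = (#|C| <= j) && (#|C| + j <= k).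
Proof. by rewrite mem_filter mem_small_subsetsT andb_idr //; lia. Qed.

Lemma mem_cells m x :
  (x \in cells m) = [&& x.1 < m, #|x.2| <= x.1 & #|x.2| + x.1 <= k].
Proof.
case: x => j C /=; apply/allpairsPdep/idP => [[j' [C' [jm CC [-> ->]]]]|].
  by move: jm CC; rewrite mem_iota mem_layer_sets add0n /= => ->.
by case/and3P=> jm c1 c2; exists j, C; rewrite mem_iota mem_layer_sets jm c1 c2.
Qed.

Lemma cells_uniq m : uniq (cells m).
Proof.
apply: allpairs_uniq_dep; first exact: iota_uniq.
  by move=> j _; rewrite filter_uniq // small_subsets_uniq.
by move=> [j C] [j' C'] _ _ /= [-> ->].
Qed.

Lemma vtx_inj : injective vtx.
Proof. by move=> [j C] [j' C'] [-> /set_name_inj ->]. Qed.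

Lemma vtx00 j : (j, 0) = vtx (j, set0).
Proof. by rewrite /vtx set_name0. Qed.

(** The move can be read off from the symmetric difference of [C] and [flip C o]. Hence the edges
    leaving a node have distinct targets. *)
Lemma flip_inj C : injective (flip C).
Proof.
have mem_flip o i : (i \in flip C o) = (o == Some i) (+) (i \in C).
  case: o => [j|] //=; have -> : (Some j == Some i) = (j == i) by [].
  by case: ifP => jC; rewrite !inE (eq_sym i j); case: eqP => [<-|] //=; rewrite jC.
move=> o o' eqo; have mem_o i : (o == Some i) = (o' == Some i).
  by apply: (@addIb (i \in C)); rewrite -!mem_flip eqo.
case: o o' mem_o {eqo} => [i|] [j|] // /(_ _) h.
- by have := h i; rewrite eqxx => /esym/eqP.
- by have := h i; rewrite eqxx.
- by have := h j; rewrite eqxx.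
Qed.

Lemma card_flip C o : #|C| <= #|flip C o| + 1 /\ #|flip C o| <= #|C| + 1.
Proof.
case: o => [i|] /=; last by slia.
case: ifP => iC.
  by rewrite (cardsD1 i C) iC add1n !addn1; split=> //; do 2! apply: leqW.
by rewrite cardsU1 iC add1n !addn1; split=> //; do 2! apply: leqW.
Qed.

Lemma mem_moves x o : (o \in moves x) = (#|flip x.2 o| + x.1.+1 <= k).
Proof.
rewrite mem_filter andb_idr // => _; rewrite in_cons.
by case: o => [i|] //=; rewrite mem_map ?mem_enum // => i' j' [].
Qed.

Lemma moves_uniq x : uniq (moves x).
Proof.
rewrite filter_uniq //= map_inj_uniq ?enum_uniq ?andbT; last by move=> i j [].
by apply/mapP => [[]].
Qed.

(** Such a move respects the bounds on the cardinal. It supplies an outgoing edge at every node but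
    the sink and, reversed, an incoming edge at every node but the source. *)
Lemma drop_move C : exists o, #|flip C o| = #|C| - 1.
Proof.
case: (set_0Vmem C) => [->|[i iC]]; first by exists None; rewrite /= cards0.
by exists (Some i); rewrite /= iC [in RHS](cardsD1 i) iC add1n subn1.
Qed.

Lemma flip_abp_wf : 0 < k -> abp_wf flip_abp.
Proof.
move=> k0; split => /=.
- by rewrite map_inj_uniq ?cells_uniq //; apply: vtx_inj.
- by rewrite all_map; apply/allP => x; rewrite mem_cells /=; slia.
- rewrite map_allpairs; apply: allpairs_uniq_dep; first exact: cells_uniq.
    by move=> x _; apply: moves_uniq.
  move=> [x o] [x' o'] _ _ /= e.
  have [ex eo] : vtx x = vtx x' /\
      vtx (x.1.+1, flip x.2 o) = vtx (x'.1.+1, flip x'.2 o').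
    by split; [move/(congr1 fst): e | move/(congr1 snd): e].
  by move: eo; rewrite (vtx_inj ex) => /vtx_inj[/flip_inj ->].
- apply/all_allpairsP => x o; rewrite mem_cells mem_moves => xP oP /=.
  have := card_flip x.2 o.
  rewrite eqxx andbT !mem_map ?mem_cells //=; try exact: vtx_inj.
  by slia.
- by split=> //; rewrite vtx00 (mem_map vtx_inj) mem_cells /= cards0.
- by split=> //; rewrite vtx00 (mem_map vtx_inj) mem_cells /= cards0 ltnSn add0n leqnn.
- move=> v /mapP[[j C]]; rewrite mem_cells /= => jC ->.
  rewrite vtx00 (inj_eq vtx_inj) map_allpairs.
  apply/idP/eqP => [|[-> ->]]; last first.
    by apply/allpairsPdep => [[x [o [_ _]]]] /=; case.
  apply: contraNeq => nz.
  (* Layer 0 contains only the empty set, which is the source. *)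
  have j0 : 0 < j.
    case: j jC nz => // /and3P[_ + _]; rewrite leqn0 cards_eq0 => /eqP ->.
    by rewrite eqxx.
  have [o oE] := drop_move C.
  apply/allpairsPdep; exists (j.-1, flip C o), o.
  (* A flip undoes itself, so the same move leads from [flip C o] back to [C]. *)
  have fK : flip (flip C o) o = C.
    case: {oE} o => [i|] //=; case: (boolP (i \in C)) => iC.
      by rewrite setD11 setD1K.
    by rewrite setU11 setU1K.
  rewrite mem_cells mem_moves /= /vtx /= fK prednK //; split=> //; slia.
- move=> v /mapP[[j C]]; rewrite mem_cells /= => jC ->.
  rewrite vtx00 (inj_eq vtx_inj) map_allpairs.
  apply/idP/eqP => [|[-> ->]]; last first.
    apply/allpairsPdep => [[x [o [+ _]]]] /=; rewrite mem_cells => /andP[xk _].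
    by case=> e; move: xk; rewrite -e ltnn.
  apply: contraNeq => nz.
  (* In layer [k] the bound [#|C| + j <= k] leaves only the empty set, which is the sink. *)
  have jk : j < k.
    rewrite ltn_neqAle; apply/andP; split; last by slia.
    apply: contra_neq nz => jk; rewrite jk; congr (_, _); apply/eqP.
    by rewrite -cards_eq0; slia.
  have [o oE] := drop_move C.
  by apply/allpairsPdep; exists (j, C), o; rewrite mem_cells mem_moves /=;
    split=> //; slia.
Qed.

Lemma size_cells m : size (cells m) <= m * binom_down n (k %/ 2).
Proof.
rewrite /cells size_allpairs_dep -{2}(size_iota 0 m) -size_small_subsets.
elim: (iota 0 m) => //= j s IH; rewrite mulSn leq_add // size_filter.
exact: count_size.
Qed.

Lemma size_flip_abp :
  abp_size flip_abp <=
    k.+1 * binom_down n (k %/ 2) + k * binom_down n (k %/ 2) * n.+1.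
Proof.
rewrite /abp_size /= size_map leq_add ?size_cells // size_allpairs_dep.
apply: leq_trans (leq_mul (size_cells k) (leqnn _)).
elim: (cells k) => //= x s IH; rewrite mulSn leq_add // size_filter.
by apply: leq_trans (count_size _ _) _; rewrite /= size_map size_enum_ord.
Qed.

Local Open Scope ring_scope.

Let value m x := walk_sum (abp_edges flip_abp) m (vtx x) (k, 0%N).

Lemma valueS m x : x \in cells k ->
  value m.+1 x = \sum_(o <- moves x)
    linform_poly (label x o) * value m (x.1.+1, flip x.2 o).
Proof.
move=> xc; rewrite /value walk_sumS big_mkcond big_allpairs_dep /=.
rewrite (bigD1_seq x) ?cells_uniq //= [X in _ + X]big1 ?addr0.
  by apply: eq_bigr => o _; rewrite eqxx.
move=> y yx; rewrite big1 // => o _.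
by rewrite (inj_eq vtx_inj) (negbTE yx).
Qed.

(** The sign absorbs the alternation between [C] and its flips, so that a letter has the same
    coefficient [coef C i] on its keeping and on its flipping edge. *)
Lemma valueE t j C : (t + j)%N = k -> (#|C| <= j)%N -> (#|C| <= t)%N ->
  value t (j, C) = (-1) ^+ #|C| * cover_sum F var j t C.
Proof.
elim: t j C => [|t IH] j C tjk Cj Ct.
  have C0 : C = set0 by apply/eqP; rewrite -cards_eq0 -leqn0.
  by rewrite /value walk_sum0 C0 cards0 cover_sum0 mulr1 vtx00 -tjk eqxx.
rewrite valueS; last by rewrite mem_cells /=; slia.
pose val' (D : {set 'I_n}) : ncpoly F V := (-1) ^+ #|D| * cover_sum F var j.+1 t D.
(* The sum may run over all moves: one that was left out leads to a set with more than [t] elements,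
   whose cover sum is zero. *)
transitivity (\sum_(o <- None :: map some (enum 'I_n))
                linform_poly (label (j, C) o) * val' (flip C o)).
  rewrite big_filter big_mkcond /=; apply: eq_bigr => o _.
  have := card_flip C o; case: ifP => [kP|/negbT kP] [c1 c2].
    by rewrite IH //; slia.
  by rewrite /val' cover_sum_big ?mulr0 //; slia.
rewrite big_cons big_map big_enum /=.
have -> : linform_poly [seq (coef C i, var j i) | i <- enum 'I_n] =
          \sum_i coef C i *: ncvar F (var j i).
  by rewrite /linform_poly big_map big_enum.
(* Each letter occurs twice, in the label of the keeping edge and on its own flipping edge; the two
   occurrences are paired. *)
rewrite mulr_suml -big_split /= cover_sumS mulr_sumr; apply: eq_bigr => i _.
rewrite /linform_poly big_seq1 /= /coef /val'.
case: ifP => iC.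
  rewrite [#|C|](cardsD1 i) iC !scaleN1r add1n exprS -signr_odd.
  case: (odd _); rewrite !(expr0, expr1, mulN1r, mul1r, mulrBr, mulrN, mulNr, opprK, opprB) //.
  by rewrite addrC.
rewrite cardsU1 iC !scale1r add1n exprS -signr_odd.
by case: (odd _); rewrite !(expr0, expr1, mulN1r, mul1r, mulrBr, mulrN, mulNr, opprK, opprB) // addrC.
Qed.

Lemma flip_abp_poly :
  abp_poly flip_abp = \sum_(w : k.-tuple 'I_n | uniq w) word_mon F var 0 w.
Proof.
rewrite abp_polyE /= [X in walk_sum _ _ X _](vtx00 0).
rewrite -[walk_sum _ _ _ _]/(value k (0%N, set0)) valueE ?addn0 ?cards0 //.
rewrite mul1r; apply: eq_bigl => w; rewrite andb_idr // => _.
by apply/subsetP => i; rewrite inE.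
Qed.

End FlipProgram.

(** * A program logic with time bounds *)

Local Notation "c1 ;; c2" := (Seq c1 c2)
  (at level 61, right associativity, format "'[v' c1 ;;  '/' c2 ']'").

Definition reg a : operand := Cell (Dir a).

Definition mov a x : cmd := Set_ (Dir a) Add x (Imm 0).

Definition for_ a lo hi body : cmd :=
  mov a lo ;; While (TLe (reg a) hi) (body ;; Set_ (Dir a) Add (reg a) (Imm 1)).

Definition set_reg (F : fieldType) (s : state F) a v : state F :=
  State (upd (mem s) a v) (fmem s) (out s).

Section Logic.

Variables (F : fieldType) (W : nat).
Hypothesis W_ge5 : 5 <= W.
Implicit Types (s : state F) (Q : state F -> nat -> Prop).

Definition bounded s := forall a, mem s a <= 2 ^ W.

(* In [wp c s T Q], time is measured in units of [8 * W.+1], an upper bound for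
   the cost of one instruction as long as all cells hold at most [2 ^ W]. [T] is
   the available time, and [Q] receives what is left of it. *)
Definition wp c s T Q := bounded s ->
  exists t s' T', [/\ exec c s t s', t + T' * (8 * W.+1) <= T * (8 * W.+1),
                      bounded s' & Q s' T'].

(** Since 32 is [2 ^ 5], the hypothesis [W_ge5] bounds the binary length of every such constant by
    [W.+1]. *)
Definition loc_ok l := match l with Dir i | Ind i => i < 32 end.
Definition op_ok x := match x with Imm c => c < 32 | Cell l => loc_ok l end.
Definition fop_ok x := match x with FCell l => loc_ok l | _ => true end.

Lemma bitlen_le a : a <= 2 ^ W -> bitlen a <= W.+1.
Proof. by move=> le; rewrite ltnS -(trunc_expnK W (isT : 1 < 2)) leq_trunc_log. Qed.

Lemma bitlen_const a : a < 32 -> bitlen a <= W.+1.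
Proof.
move=> lt; apply: bitlen_le; apply: (leq_trans (ltnW lt)).
exact: (@leq_pexp2l 2 5 W).
Qed.

Lemma cost_loc_le s l : bounded s -> loc_ok l -> cost_loc s l <= 2 * W.+1.
Proof.
move=> bs; case: l => i /= /bitlen_const; first by lia.
by have := bitlen_le (bs i); lia.
Qed.

Lemma cost_op_le s x : bounded s -> op_ok x -> cost_op s x <= 3 * W.+1.
Proof.
move=> bs; case: x => [c /bitlen_const|l] /=; first by lia.
by move=> /(cost_loc_le bs); have := bitlen_le (bs (addr s l)); lia.
Qed.

Lemma cost_fop_le s x : bounded s -> fop_ok x -> cost_fop s x <= 3 * W.+1.
Proof. by move=> bs; case: x => [||l] //= /(cost_loc_le bs); lia. Qed.

Lemma bounded_upd s a v fm o : bounded s -> v <= 2 ^ W ->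
  bounded (State (upd (mem s) a v) fm o).
Proof. by move=> bs bv b; rewrite /= /upd; case: ifP. Qed.

Lemma wp_skip s T Q : Q s T -> wp Skip s T.+1 Q.
Proof. by move=> q bs; exists 1, s, T; split=> //; [exact: exec_skip|lia]. Qed.

Lemma wp_set l op x y s T Q : [&& loc_ok l, op_ok x & op_ok y] ->
  (bounded s -> eval_natop op (eval s x) (eval s y) <= 2 ^ W) ->
  Q (set_reg s (addr s l) (eval_natop op (eval s x) (eval s y))) T ->
  wp (Set_ l op x y) s T.+1 Q.
Proof.
case/and3P=> lP xP yP bv q bs; do 3! eexists; split; [exact: exec_set| | |exact: q].
(* The target costs at most 2 and each operand at most 3 times [W.+1]; hence the factor 8 in the
   unit of time. *)
- have := cost_loc_le bs lP; have := cost_op_le bs xP; have := cost_op_le bs yP.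
  by lia.
- by apply: bounded_upd => //; apply: bv.
Qed.

Lemma wp_fset l op x y s T Q : [&& loc_ok l, fop_ok x & fop_ok y] ->
  Q (State (mem s) (upd (fmem s) (addr s l)
       (eval_fieldop op (feval s x) (feval s y))) (out s)) T ->
  wp (FSet l op x y) s T.+1 Q.
Proof.
case/and3P=> lP xP yP q bs; do 3! eexists; split;
  [exact: exec_fset| |by []|exact: q].
have := cost_loc_le bs lP; have := cost_fop_le bs xP; have := cost_fop_le bs yP.
by lia.
Qed.

Lemma wp_write x s T Q : op_ok x ->
  Q (State (mem s) (fmem s) (rcons (out s) (inl (eval s x)))) T ->
  wp (Write x) s T.+1 Q.
Proof.
move=> xP q bs; do 3! eexists; split; [exact: exec_write| |by []|exact: q].
by have := cost_op_le bs xP; lia.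
Qed.

Lemma wp_fwrite x s T Q : fop_ok x ->
  Q (State (mem s) (fmem s) (rcons (out s) (inr (feval s x)))) T ->
  wp (FWrite x) s T.+1 Q.
Proof.
move=> xP q bs; do 3! eexists; split; [exact: exec_fwrite| |by []|exact: q].
by have := cost_fop_le bs xP; lia.
Qed.

Lemma wp_seq c1 c2 s T Q :
  wp c1 s T (fun s1 T1 => wp c2 s1 T1 Q) -> wp (c1 ;; c2) s T Q.
Proof.
move=> w bs; have [t1 [s1 [T1 [e1 le1 bs1 w1]]]] := w bs.
have [t2 [s2 [T2 [e2 le2 bs2 q]]]] := w1 bs1.
by exists (t1 + t2), s2, T2; split=> //; [exact: exec_seq e1 e2|lia].
Qed.

Lemma cost_test_le s x y : bounded s -> op_ok x -> op_ok y ->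
  cost_test s (TLe x y) <= 8 * W.+1.
Proof.
move=> bs xP yP /=; have := cost_op_le bs xP; have := cost_op_le bs yP; lia.
Qed.

Lemma wp_if x y c1 c2 s T Q : op_ok x && op_ok y ->
  wp (if eval s x <= eval s y then c1 else c2) s T Q ->
  wp (If (TLe x y) c1 c2) s T.+1 Q.
Proof.
case/andP=> xP yP w bs; have [t [s' [T' [e le bs' q]]]] := w bs.
exists (cost_test s (TLe x y) + t), s', T'; split=> //; first exact: exec_if.
by have := cost_test_le bs xP yP; lia.
Qed.

(** [R i] is the invariant at the loop head. An iteration pays [Tb] for the body and one unit each
    for test and increment; the first assignment and the last, failing test make up the extra 2. *)
Lemma wp_for a lo hi body (l h : nat) (R : nat -> state F -> Prop) Tb s T Q :
  [&& a < 32, op_ok lo & op_ok hi] -> eval s lo = l -> l <= h.+1 -> h < 2 ^ W ->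
  (forall i s, R i s -> mem s a = i /\ eval s hi = h) ->
  (forall i s, l <= i <= h -> R i s ->
     wp body s Tb (fun s' _ => mem s' a = i /\ R i.+1 (set_reg s' a i.+1))) ->
  R l (set_reg s a l) ->
  (forall s', R h.+1 s' -> Q s' T) ->
  wp (for_ a lo hi body) s ((h.+1 - l) * Tb.+2 + 2 + T) Q.
Proof.
case/and3P=> aP loP hiP sl lh hW Rreg Rbody Rl RQ.
rewrite -addnA addSnnS addnA addnS; apply: wp_seq; apply: wp_set.
- by rewrite /= aP loP.
- by move=> _; rewrite /= sl addn0; apply: leq_trans hW.
rewrite /= sl addn0; move: (set_reg s a l) Rl => {sl} {}s Rl.
have tP : op_ok (reg a) by [].
have [m mE] : {m | m = h.+1 - l} by exists (h.+1 - l).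
rewrite -mE; elim: m l lh Rbody mE s Rl => [|m IH] l lh Rbody mE s Rl bs.
  have [sa sh] := Rreg _ _ Rl.
  have lE : l = h.+1 by lia.
  exists (cost_test s (TLe (reg a) hi)), s, T; split=> //.
  - by apply: exec_while_false; rewrite /= sa sh lE ltnn.
  - by have := cost_test_le bs tP hiP; lia.
  - by apply: RQ; rewrite -lE.
have [sa sh] := Rreg _ _ Rl.
have lP : l <= l <= h by lia.
have [t1 [s1 [T1 [e1 le1 bs1 [s1a R1]]]]] := Rbody _ _ lP Rl bs.
(* The counter ends at [h.+1], so [h] has to lie strictly below [2 ^ W]. *)
have bs2 : bounded (set_reg s1 a l.+1) by apply: bounded_upd => //; lia.
have [] := IH l.+1 _ _ _ _ R1 bs2.
- by lia.
- by move=> i s' /andP[li ih]; apply: Rbody; lia.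
- by lia.
move=> t2 [s2 [T2 [e2 le2 bs3 q]]].
have e3 := exec_set s1 (Dir a) Add (reg a) (Imm 1).
rewrite /= s1a addn1 in e3.
eexists _, s2, T2; split=> //.
  apply: exec_while_true e2; last exact: exec_seq e1 e3.
  by rewrite /= sa sh; lia.
have := cost_test_le bs tP hiP.
have := cost_loc_le bs1 (aP : loc_ok (Dir a)); have := cost_op_le bs1 tP.
have : cost_op s1 (Imm 1) <= 3 * W.+1 by apply: cost_op_le.
move: le1 le2; rewrite /= s1a; lia.
Qed.

(** Keeps the accumulated output out of the invariant [R]; only the contribution [w i] of one
    iteration has to be verified. *)
Lemma wp_for_out a lo hi body (l h : nat) (R : nat -> state F -> Prop)
    (w : nat -> seq (symb F)) Tb s T Q :
  [&& a < 32, op_ok lo & op_ok hi] -> eval s lo = l -> l <= h.+1 -> h < 2 ^ W ->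
  (forall i s, R i s -> mem s a = i /\ eval s hi = h) ->
  (forall i s, l <= i <= h -> R i s ->
     wp body s Tb (fun s' _ => [/\ mem s' a = i, R i.+1 (set_reg s' a i.+1)
                                 & out s' = out s ++ w i])) ->
  R l (set_reg s a l) ->
  (forall s', R h.+1 s' ->
     out s' = out s ++ flatten [seq w i | i <- iota l (h.+1 - l)] -> Q s' T) ->
  wp (for_ a lo hi body) s ((h.+1 - l) * Tb.+2 + 2 + T) Q.
Proof.
move=> okP sl lh hW Rreg Rbody Rl RQ.
pose R' i s' := [/\ l <= i, R i s' &
  out s' = out s ++ flatten [seq w i' | i' <- iota l (i - l)]].
apply: (@wp_for _ _ _ _ l h R') => //.
- by move=> i s' [_ /Rreg].
- move=> i s1 ih [li Ri oi] bs.
  have [t [s2 [T' [e le bs' [s2a R2 o2]]]]] := Rbody _ _ ih Ri bs.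
  exists t, s2, T'; split=> //; split=> //; split=> //; first by lia.
  rewrite /= o2 oi subSn // -addn1 iotaD map_cat flatten_cat /= cats0.
  by rewrite subnKC // catA.
- by split=> //=; rewrite subnn cats0.
- by move=> s' [_ Rh oh]; apply: RQ.
Qed.

End Logic.

(** * The machine program *)

Local Arguments upd T f a x b /.
Local Arguments set_reg F s a v /.

(* Cells 0 and 1 hold n and k, 2 holds k %/ 2, 3 holds 2 ^ n, 4 the address of
   the last entry of the array, 5 and 6 hold n - 1 and k - 1. Cells 7 to 19 are
   scratch, and the names of the subsets are stored from cell 20 on. Field cell 0
   holds -1. *)
Definition prep : cmd :=
  Set_ (Dir 2) Div (reg 1) (Imm 2) ;;
  Set_ (Dir 5) Sub (reg 0) (Imm 1) ;;
  Set_ (Dir 6) Sub (reg 1) (Imm 1) ;;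
  FSet (Dir 0) FSub FZero FOne ;;
  mov 3 (Imm 1) ;;
  for_ 13 (Imm 0) (reg 5) (Set_ (Dir 3) Mul (reg 3) (Imm 2)).

(** Cell 7 points to the entry being read and cell 14 holds [2 ^ i], so the pushed number is the old
    name plus [2 ^ n + 2 ^ i]. *)
Definition grow_body : cmd :=
  mov 10 (Cell (Ind 7)) ;;
  Set_ (Dir 11) Div (reg 10) (reg 3) ;;
  Set_ (Dir 11) Add (reg 11) (Imm 1) ;;
  If (TLe (reg 11) (reg 2))
    (Set_ (Dir 4) Add (reg 4) (Imm 1) ;;
     Set_ (Dir 10) Add (reg 10) (reg 3) ;;
     Set_ (Ind 4) Add (reg 10) (reg 14))
    Skip.

(** Cell 8 freezes the end of the list before each pass, so that entries pushed during the pass are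
    not extended again. *)
Definition enumerate : cmd :=
  mov 20 (Imm 0) ;;
  mov 4 (Imm 20) ;;
  mov 14 (Imm 1) ;;
  for_ 13 (Imm 0) (reg 5)
    (mov 8 (reg 4) ;;
     for_ 7 (Imm 20) (reg 8) grow_body ;;
     Set_ (Dir 14) Mul (reg 14) (Imm 2)).

(** Cell 9 is the layer and cell 10 the name of the set. Cell 11 holds the cardinal for the first
    test and the cardinal plus the layer for the second. *)
Definition for_cells (hi : operand) (body : cmd) : cmd :=
  for_ 9 (Imm 0) hi
    (for_ 7 (Imm 20) (reg 4)
      (mov 10 (Cell (Ind 7)) ;;
       Set_ (Dir 11) Div (reg 10) (reg 3) ;;
       If (TLe (reg 11) (reg 9))
         (Set_ (Dir 11) Add (reg 11) (reg 9) ;;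
          If (TLe (reg 11) (reg 1)) body Skip)
         Skip)).

Definition write_node : cmd :=
  Write (Imm 0) ;; Write (reg 9) ;; Write (reg 10).

(** The quotient in cell 15 exceeds its even part in cell 16 exactly when the element belongs to the
    set; then [c1] runs. *)
Definition if_bit (c1 c2 : cmd) : cmd :=
  Set_ (Dir 15) Div (reg 10) (reg 14) ;;
  Set_ (Dir 16) Div (reg 15) (Imm 2) ;;
  Set_ (Dir 16) Mul (reg 16) (Imm 2) ;;
  If (TLe (reg 15) (reg 16)) c2 c1.

Definition write_term (wvar : cmd) (x : foperand) : cmd :=
  Write (Imm 2) ;; FWrite x ;; wvar.

Definition minus_one : foperand := FCell (Dir 0).

Definition write_stay (wvar : cmd) : cmd :=
  if_bit (write_term wvar minus_one) (write_term wvar FOne) ;;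
  Set_ (Dir 14) Mul (reg 14) (Imm 2).

Definition write_head : cmd :=
  Write (Imm 1) ;; Write (reg 9) ;; Write (reg 10) ;; Write (reg 12).

Definition write_flip (wvar : cmd) : cmd :=
  if_bit
    (Set_ (Dir 17) Sub (reg 10) (reg 3) ;;
     Set_ (Dir 17) Sub (reg 17) (reg 14) ;;
     write_head ;; Write (reg 17) ;; write_term wvar minus_one)
    (If (TLe (reg 11) (reg 1))
       (Set_ (Dir 17) Add (reg 10) (reg 3) ;;
        Set_ (Dir 17) Add (reg 17) (reg 14) ;;
        write_head ;; Write (reg 17) ;; write_term wvar FOne)
       Skip) ;;
  Set_ (Dir 14) Mul (reg 14) (Imm 2).

(** Cell 11 is raised to [#|C| + j + 1] to test the keeping edge, and once more for the test in
    [write_flip] whether an element may enter. *)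
Definition write_edges (wvar : cmd) : cmd :=
  Set_ (Dir 12) Add (reg 9) (Imm 1) ;;
  Set_ (Dir 11) Add (reg 11) (Imm 1) ;;
  If (TLe (reg 11) (reg 1))
    (write_head ;; Write (reg 10) ;; mov 14 (Imm 1) ;;
     for_ 13 (Imm 0) (reg 5) (write_stay wvar))
    Skip ;;
  Set_ (Dir 11) Add (reg 11) (Imm 1) ;;
  mov 14 (Imm 1) ;;
  for_ 13 (Imm 0) (reg 5) (write_flip wvar).

(** [wvar] prints a variable, given its layer in cell 9 and its letter in cell 13; nothing else
    differs between the two families. *)
Definition program (wvar : cmd) : cmd :=
  prep ;;
  enumerate ;;
  Write (reg 1) ;; Write (Imm 0) ;; Write (Imm 0) ;; Write (reg 1) ;;
  Write (Imm 0) ;;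
  for_cells (reg 1) write_node ;;
  for_cells (reg 6) (write_edges wvar).

(** * Correctness and running time of the program *)

Section Correctness.

Variables (F : fieldType) (V : choiceType) (n k : nat) (var : nat -> 'I_n -> V).
Variables (code : V -> seq nat) (wvar : cmd).
Hypotheses (n_gt0 : 0 < n) (k_gt0 : 0 < k).
Implicit Types (m : nat -> nat) (fm : nat -> F) (s : state F) (C : {set 'I_n}).

(** Makes [2 ^ width] exceed the names, which are below [2 ^ (n + n)], the addresses, at most
    [20 + 2 ^ n.+1], and the counters, linear in [n] and [k]. *)
Definition width := n + n + k + 6.

Hypothesis wvarP : forall s j (i : 'I_n) T Q,
  j < k -> mem s 9 = j -> mem s 13 = i ->
  Q (State (mem s) (fmem s) (out s ++ nats F (code (var j i)))) T ->
  wp width wvar s T.+2 Q.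

Notation W := width.
Notation r := (k %/ 2).
Notation subsets := (small_subsets n r).

Lemma width_ge5 : 5 <= W. Proof. by rewrite /width; lia. Qed.
Hint Resolve width_ge5 : core.

Lemma small_le x : x <= n + k + 40 -> x <= 2 ^ W.
Proof.
move=> le; have lt := ltn_expl (n + k) (isT : 1 < 2).
rewrite /width (_ : n + n + k + 6 = n + ((n + k) + 6)); last by lia.
rewrite expnD (expnD _ (n + k)) -[x]mul1n leq_mul ?expn_gt0 //.
by rewrite (_ : 2 ^ 6 = 64) //; lia.
Qed.

Lemma card_le_width C x : x <= k + 40 -> #|C| + x <= 2 ^ W.
Proof.
move=> xk; apply: small_le; rewrite -addnA leq_add //.
by rewrite -[n in leqRHS]card_ord max_card.
Qed.

Lemma pow_le : 20 + 2 ^ n.+1 < 2 ^ W.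
Proof.
rewrite /width (_ : n + n + k + 6 = (n + k) + (n + 6)); last by lia.
rewrite expnD (expnD _ n 6) (_ : 2 ^ 6 = 64) // expnS.
have : 0 < 2 ^ n by rewrite expn_gt0.
have : 0 < 2 ^ (n + k) by rewrite expn_gt0.
by move: (2 ^ n) (2 ^ (n + k)) => a b; nia.
Qed.

Lemma exp_le i : i <= n -> 2 ^ i <= 2 ^ W.
Proof. by move=> le; rewrite leq_exp2l // /width; lia. Qed.

Lemma name_le C : set_name C <= 2 ^ W.
Proof.
apply: (leq_trans (ltnW (set_name_lt C))).
by rewrite leq_exp2l // /width; lia.
Qed.

Definition regs m :=
  [/\ m 0 = n, m 1 = k, m 2 = r & [/\ m 3 = 2 ^ n, m 5 = n.-1 & m 6 = k.-1]].

Definition arr (l : seq nat) m :=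
  m 4 = 19 + size l /\ forall q, q < size l -> m (20 + q) = nth 0 l q.

Definition ready m fm := [/\ regs m, arr (map (@set_name n) (subsets n)) m & fm 0 = (-1)%R].

Lemma arr_upd l m a v : 4 < a < 20 -> arr l m -> arr l (upd m a v).
Proof.
move=> aP [m4 mq]; split=> [|q ql] /=.
  by rewrite [_ == a](_ : _ = false); last by lia.
by rewrite [_ == a](_ : _ = false); [exact: mq|lia].
Qed.

Lemma arr_push l m a v : a = 20 + size l -> m 4 = a ->
  (forall q, q < size l -> m (20 + q) = nth 0 l q) ->
  arr (rcons l v) (upd m a v).
Proof.
move=> aE m4 mq; split=> [|q]; rewrite size_rcons /=.
  by rewrite [_ == a](_ : _ = false); lia.
rewrite nth_rcons ltnS leq_eqVlt => /orP[/eqP->|ql].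
  by rewrite aE ltnn !eqxx.
by rewrite ql [_ == a](_ : _ = false); [exact: mq|lia].
Qed.

Lemma wp_le c s T T' (Q : state F -> nat -> Prop) :
  T' <= T -> wp W c s T' Q -> wp W c s T Q.
Proof.
move=> le w bs; have [t [s' [T1 [e le1 bs' q]]]] := w bs.
exists t, s', T1; split=> //; apply: leq_trans le1 _.
by rewrite leq_mul2r le orbT.
Qed.

Lemma wp_post c s T (Q Q' : state F -> nat -> Prop) :
  (forall s' T', Q' s' T' -> Q s' T') -> wp W c s T Q' -> wp W c s T Q.
Proof.
move=> QQ w bs; have [t [s' [T1 [e le1 bs' q]]]] := w bs.
by exists t, s', T1; split=> //; apply: QQ.
Qed.

Ltac step := first [apply: wp_seq => // | apply: wp_set => //= | apply: wp_write => //= |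
   apply: wp_fwrite => //= | apply: wp_fset => //= | apply: wp_if => //= | apply: wp_skip => //=].

Lemma prepP T (Q : state F -> nat -> Prop) :
  (forall s, regs (mem s) -> fmem s 0 = (-1)%R -> out s = [::] -> Q s T) ->
  wp W prep (init F n k) (n * 3 + 2 + T).+4.+1 Q.
Proof.
move=> H; rewrite /prep; do 2 step.
  by move=> _; apply: small_le; have := leq_div k 2; lia.
do 2 step; first by move=> _; apply: small_le; lia.
do 2 step; first by move=> _; apply: small_le; lia.
do 4 step; first by move=> _; apply: small_le; lia.
rewrite !subn1 sub0r addn0 /=.
have -> : n * 3 + 2 + T = (n.-1.+1 - 0) * 3 + 2 + T by rewrite prednK ?subn0.
apply: (@wp_for _ _ _ _ _ _ _ 0 n.-1 (fun i s => [/\ [/\ mem s 0 = n, mem s 1 = k,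
  mem s 2 = r, mem s 5 = n.-1 & mem s 6 = k.-1], mem s 3 = 2 ^ i, mem s 13 = i,
  fmem s 0 = (-1)%R & out s = [::]])) => //.
- by apply: small_le; lia.
- by move=> i s [[_ _ _ e5 _] _ e13 _ _].
- move=> i s ii [[e0 e1 e2 e5 e6] e3 e13 ef eo]; step.
    by move=> _; rewrite e3 -expnSr exp_le //; lia.
  by rewrite e3 -expnSr.
- move=> s [[e0 e1 e2 e5 e6] e3 e13 ef eo]; apply: H => //.
  by rewrite prednK // in e3.
Qed.

(** The entries before address [p] have been read, and their extensions stand behind the list of the
    previous round. *)
Definition grow_inv (i : 'I_n) p s :=
  [/\ regs (mem s), fmem s 0 = (-1)%R, out s = [::] &
   [/\ mem s 7 = p, mem s 8 = 19 + size (subsets i), mem s 13 = i, mem s 14 = 2 ^ i &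
   arr (map (@set_name n) (subsets i ++
     [seq i |: C | C <- take (p - 20) (subsets i) & #|C : {set 'I_n}| < r])) (mem s)]].

Lemma grow_bodyP (i : 'I_n) p s :
  20 <= p <= 19 + size (subsets i) -> grow_inv i p s ->
  wp W grow_body s 7
    (fun s' _ => mem s' 7 = p /\ grow_inv i p.+1 (set_reg s' 7 p.+1)).
Proof.
move=> pP [rg ef eo [e7 e8 e13 e14 [a4 aq]]].
have [q qE qlt] : {q | p = 20 + q & q < size (subsets i)} by exists (p - 20); lia.
set C := nth set0 (subsets i) q.
have CL : C \in subsets i by rewrite mem_nth.
have iC : i \notin C.
  move: CL; rewrite (mem_small_subsets _ _ (ltnW (ltn_ord i))) => /andP[/forall_inP lt _].
  by apply/negP => /lt; rewrite ltnn.
have memp : mem s p = set_name C.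
  rewrite qE aq ?size_map ?size_cat ?ltn_addr // map_cat nth_cat size_map qlt.
  by rewrite (nth_map set0).
have [_ _ e2 [e3 _ _]] := rg.
have pE : p.+1 - 20 = q.+1 by lia.
rewrite /grow_inv pE (take_nth set0 qlt) -/C filter_rcons.
set l := subsets i ++ _ in aq a4 *.
have lE : l = subsets i ++ [seq i |: C0 | C0 <- take q (subsets i) & #|C0 : {set 'I_n}| < r].
  by rewrite /l qE addKn.
(* One pass at most doubles the list, so the next address still fits into a cell. *)
have size_l : size (map (@set_name n) l) <= 2 ^ n.+1.
  rewrite size_map lE size_cat size_map size_filter expnS mul2n -addnn.
  have sz := size_small_subsets_le r (ltnW (ltn_ord i)).
  apply: leq_add => //; apply: leq_trans (count_size _ _) _.
  by rewrite size_take qlt; lia.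
rewrite /grow_body; do 2 step; first by move=> bs; rewrite addn0.
rewrite addn0 e7 memp.
do 2 step; first by move=> bs; rewrite (leq_trans (leq_div _ _)) // name_le.
rewrite e3 set_name_div.
do 2 step; first by move=> bs; apply: card_le_width; lia.
rewrite addn1; step; rewrite e2; case: ifP => Cr; last first.
  by step; rewrite -lE.
do 2 step.
  move=> bs; rewrite a4; have := pow_le; lia.
do 2 step.
  move=> bs; rewrite e3; apply: leq_trans (name_le (i |: C)).
  by rewrite set_nameU1 // leq_addr.
step.
  move=> bs; rewrite e3 e14; apply: leq_trans (name_le (i |: C)).
  by rewrite set_nameU1.
rewrite e3 e14 -set_nameU1 // a4.
(* The push goes to an address beyond the registers and leaves them alone. *)
have nE a : a < 20 -> (a == 19 + size (map (@set_name n) l) + 1) = false by lia.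
rewrite !nE //=; split=> //.
rewrite map_rcons -rcons_cat -lE map_rcons.
split=> //; split=> //=; rewrite ?nE //; apply: arr_upd => //.
by apply: arr_push => //=; lia.
Qed.


Notation total := (binom_down n r).

Lemma size_subsets_le i : i <= n -> size (subsets i) <= total.
Proof.
move=> le; rewrite -size_small_subsets; apply: uniq_leq_size => [|C].
  exact: small_subsets_uniq.
by rewrite mem_small_subsetsT mem_small_subsets // => /andP[].
Qed.

Lemma size_subsets_gt0 i : 0 < size (subsets i).
Proof.
elim: i => [|i]; first by rewrite /small_subsets take0.
case: (ltnP i n) => [lt|le]; last first.
  by rewrite /small_subsets !take_oversize ?size_enum_ord // ltnW.
by rewrite (small_subsetsS _ (Ordinal lt)) size_cat => ?; rewrite ltn_addr.
Qed.

Definition enum_inv i s :=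
  [/\ regs (mem s), fmem s 0 = (-1)%R, out s = [::] &
   [/\ mem s 13 = i, mem s 14 = 2 ^ i &
       arr (map (@set_name n) (subsets i)) (mem s)]].

Definition enum_time := n * (total * 9 + 2).+4.

Lemma enum_stepP i s : i < n -> enum_inv i s ->
  wp W (mov 8 (reg 4) ;; for_ 7 (Imm 20) (reg 8) grow_body ;;
        Set_ (Dir 14) Mul (reg 14) (Imm 2)) s (total * 9 + 2).+2
    (fun s' _ => mem s' 13 = i /\ enum_inv i.+1 (set_reg s' 13 i.+1)).
Proof.
move=> lt [rg ef eo [e13 e14 ar]]; have [a4 aq] := ar.
do 2 step; first by move=> bs; rewrite addn0.
rewrite addn0 a4 size_map; step.
set i' := Ordinal lt.
have sz := size_subsets_le (ltnW lt).
apply: (@wp_le _ _ _ (((19 + size (subsets i)).+1 - 20) * 9 + 2 + 1)).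
  by move: (size _) sz => x; lia.
apply: (@wp_for _ _ _ _ _ _ _ 20 (19 + size (subsets i)) (grow_inv i')) => //.
- have := size_small_subsets_le r (ltnW lt); have := pow_le; rewrite expnS; lia.
- by move=> p s' [_ _ _ [e7 e8 _ _ _]].
- by move=> p s'; apply: (@grow_bodyP i').
- split=> //=; split=> //=; do 2! apply: arr_upd => //.
  by rewrite subnn take0 /= cats0.
move=> s' [rg' ef' eo' [e7' e8' e13' e14']].
rewrite -addSn addKn take_size => ar'.
step; first by move=> bs; rewrite e14' -expnSr exp_le.
split=> //; split=> //=; split=> //=; first by rewrite e14' -expnSr.
do 2! apply: arr_upd => //.
by rewrite (small_subsetsS _ i').
Qed.

Lemma enumerateP s T (Q : state F -> nat -> Prop) :
  regs (mem s) -> fmem s 0 = (-1)%R -> out s = [::] ->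
  (forall s', ready (mem s') (fmem s') -> out s' = [::] -> Q s' T) ->
  wp W enumerate s (enum_time + 2 + T).+3 Q.
Proof.
move=> rg ef eo H; rewrite /enumerate; do 2 step.
do 2 step; first by move=> _; apply: small_le; lia.
do 2 step; first by move=> _; apply: small_le; lia.
have -> : enum_time = (n.-1.+1 - 0) * (total * 9 + 2).+4 by rewrite prednK ?subn0.
apply: (@wp_for _ _ _ _ _ _ _ 0 n.-1 enum_inv) => //.
- by apply: small_le; lia.
- by move=> i s' [[_ _ _ [_ e5 _]] _ _ [e13 _ _]].
- by move=> i s' ii; apply: enum_stepP; lia.
- split=> //; split=> //; rewrite /small_subsets take0 /= set_name0.
  by split=> // -[|q].
- move=> s' [rg' ef' eo' [_ _ ar]]; apply: H => //.
  by rewrite prednK // in ar.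
Qed.

(** Trades the filters in [cells] for the tests that the machine makes inside its two loops. *)
Lemma flatten_cells (T : Type) (g : nat * {set 'I_n} -> seq T) h :
  flatten (map g (cells n k h)) =
  flatten [seq flatten [seq if (#|C : {set 'I_n}| <= j) && (#|C| + j <= k) then g (j, C)
                            else [::] | C <- subsets n] | j <- iota 0 h].
Proof.
rewrite /cells; elim: (iota 0 h) => //= j l IH.
rewrite map_cat flatten_cat IH; congr (_ ++ _).
rewrite /layer_sets; elim: (subsets n) => //= C L <-.
by case: ifP.
Qed.

Lemma map_iota20 (T : Type) (f : {set 'I_n} -> T) :
  [seq f (nth set0 (subsets n) (p - 20)) | p <- iota 20 (size (subsets n))] =
  map f (subsets n).
Proof.
rewrite (iotaDl 20 0) -map_comp -{3}(mkseq_nth set0 (subsets n)) -map_comp.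
by apply: eq_map => q /=; rewrite addKn.
Qed.

Lemma for_cellsP hi body h (g : nat * {set 'I_n} -> seq (symb F)) Tb s T
    (Q : state F -> nat -> Prop) :
  op_ok hi -> h <= k ->
  (forall s, ready (mem s) (fmem s) -> eval s hi = h) ->
  (forall s j C, j <= h -> C \in layer_sets n k j -> ready (mem s) (fmem s) ->
     mem s 9 = j -> mem s 10 = set_name C -> mem s 11 = #|C| + j ->
     wp W body s Tb.+1 (fun s' _ => [/\ ready (mem s') (fmem s'), mem s' 9 = j,
       mem s' 7 = mem s 7 & out s' = out s ++ g (j, C)])) ->
  ready (mem s) (fmem s) ->
  (forall s', ready (mem s') (fmem s') ->
     out s' = out s ++ flatten (map g (cells n k h.+1)) -> Q s' T) ->
  wp W (for_cells hi body) s (h.+1 * (total * Tb.+4.+4 + 2).+2 + 2 + T) Q.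
Proof.
move=> hiP hk hiE bodyP rd H.
rewrite -{1}(subn0 h.+1).
pose w j := flatten [seq if (#|C : {set 'I_n}| <= j) && (#|C| + j <= k) then g (j, C)
                            else [::] | C <- subsets n].
apply: (@wp_for_out _ _ _ _ _ _ _ 0 h
  (fun j s => ready (mem s) (fmem s) /\ mem s 9 = j) w) => //.
- by apply: small_le; lia.
- by move=> j s' [rd' ?]; split=> //; apply: hiE.
- move=> j s1 jh [rd1 e9]; have [rg [a4 aq] ef] := rd1.
  rewrite size_map in a4 aq.
  rewrite -size_small_subsets; set sz := size _ in a4 aq *.
  have sz0 : 0 < sz by apply: size_subsets_gt0.
  have -> : sz * Tb.+4.+4 + 2 = ((19 + sz).+1 - 20) * Tb.+4.+4 + 2 + 0.
    by rewrite -addSn addKn addn0.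
  (* The inner loop counts addresses, and address [p] holds entry number [p - 20]. *)
  pose w1 p := let C := nth set0 (subsets n) (p - 20) in
    if (#|C| <= j) && (#|C| + j <= k) then g (j, C) else [::].
  apply: (@wp_for_out _ _ _ _ _ _ _ 20 (19 + sz) (fun p s => [/\ ready (mem s) (fmem s),
    mem s 9 = j & mem s 7 = p]) w1) => //.
  + have := size_small_subsets_le r (leqnn n); rewrite -/sz; have := pow_le;
    rewrite expnS; lia.
  + by move=> p s' [[_ [a4' _] _] _ ?]; split=> //; rewrite /= a4' size_map.
  + move=> p s2 ph [rd2 e9' e7]; have [rg2 [_ aq2] _] := rd2.
    have [q qE qlt] : {q | p = 20 + q & q < sz} by exists (p - 20); lia.
    rewrite /w1 qE addKn; set C := nth _ _ _.
    have memp : mem s2 p = set_name C.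
      by rewrite qE aq2 ?size_map // (nth_map set0).
    have [_ e1 _ [e3 _ _]] := rg2.
    do 2 step; first by move=> bs; rewrite addn0.
    rewrite addn0 e7 memp; do 2 step.
      by move=> bs; rewrite (leq_trans (leq_div _ _)) // name_le.
    rewrite e3 set_name_div; step; rewrite e9'; case: ifP => /= Cj; last first.
      by step; rewrite cats0; rewrite -?qE.
    do 2 step; first by move=> bs; apply: card_le_width; rewrite e9'; lia.
    step; rewrite e1 e9'; case: ifP => /= Ck; last first.
      by step; rewrite cats0; rewrite -?qE.
    apply: wp_post; last first.
      apply: (bodyP _ j C) => //=.
      + by rewrite mem_layer_sets Cj Ck.
    move=> s' _ /= [rd' e9'' e7' o']; rewrite -qE; split=> //; first by rewrite e7'.
  move=> s' [rd' e9' e7'] o'; split=> //.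
  rewrite o' -addSn addKn /w; congr (_ ++ flatten _).
  exact: (map_iota20 (fun C => if (#|C| <= j) && (#|C| + j <= k) then g (j, C) else [::])).
move=> s' [rd' _] o'; apply: H => //.
by rewrite o' subn0 flatten_cells.
Qed.


Lemma flatten_ord (T : Type) (f : 'I_n -> seq T) :
  flatten [seq oapp f [::] (insub i) | i <- iota 0 n] =
  flatten [seq f i | i <- enum 'I_n].
Proof.
by rewrite -val_enum_ord -map_comp; congr flatten; apply: eq_map => i /=;
  rewrite valK.
Qed.

Lemma write_nodeP s j C : ready (mem s) (fmem s) ->
  mem s 9 = j -> mem s 10 = set_name C ->
  wp W write_node s 3 (fun s' _ => [/\ ready (mem s') (fmem s'), mem s' 9 = j,
    mem s' 7 = mem s 7 & out s' = out s ++ nats F [:: 0; j; set_name C]]).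
Proof.
move=> rd e9 e10; rewrite /write_node; do 5 step.
by rewrite e9 e10 -!cats1 -!catA.
Qed.

Lemma if_bitP C (i : 'I_n) c1 c2 s T (Q : state F -> nat -> Prop) :
  mem s 10 = set_name C -> mem s 14 = 2 ^ i ->
  (forall x y z, wp W (if i \in C then c1 else c2)
     (State (upd (upd (upd (mem s) 15 x) 16 y) 16 z) (fmem s) (out s)) T Q) ->
  wp W (if_bit c1 c2) s T.+4 Q.
Proof.
move=> e10 e14 H; rewrite /if_bit; do 2 step.
  by move=> bs; rewrite (leq_trans (leq_div _ _)).
do 2 step; first by move=> bs; rewrite (leq_trans (leq_div _ _)) // (bs 15).
do 2 step.
  by move=> bs; rewrite (leq_trans (leq_trunc_div _ _)) // (bs 15).
step; rewrite e10 e14; set b := _ %/ 2 ^ i.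
have -> : (b <= b %/ 2 * 2) = (i \notin C).
  rewrite -set_name_bit -/b {1}(divn_eq b 2) modn2.
  by rewrite -[leqRHS]addn0 leq_add2l; case: (odd b).
by rewrite if_neg.
Qed.

Lemma write_termP x j (i : 'I_n) s T (Q : state F -> nat -> Prop) :
  fop_ok x -> j < k -> mem s 9 = j -> mem s 13 = i ->
  Q (State (mem s) (fmem s)
       (out s ++ enc_term code (feval s x, var j i))) T ->
  wp W (write_term wvar x) s T.+4 Q.
Proof.
move=> xP jk e9 e13 q; rewrite /write_term; do 4 step.
apply: (wvarP (j := j) (i := i)) => //=.
by move: q; rewrite /enc_term /= -!cats1 -!catA.
Qed.

Definition edge_inv j C c p s :=
  [/\ ready (mem s) (fmem s), mem s 9 = j, mem s 10 = set_name C, mem s 11 = c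
    & mem s 12 = j.+1 /\ mem s 7 = p].

Definition label_inv j C c p i s :=
  [/\ edge_inv j C c p s, mem s 13 = i & mem s 14 = 2 ^ i].

Lemma write_stayP j C c p i s : j < k -> i < n -> label_inv j C c p i s ->
  wp W (write_stay wvar) s 9 (fun s' _ =>
    [/\ mem s' 13 = i, label_inv j C c p i.+1 (set_reg s' 13 i.+1) &
        out s' = out s ++ oapp (fun i => enc_term code (coef F C i, var j i)) [::] (insub i)]).
Proof.
move=> jk lt [[rd e9 e10 e11 [e12 e7]] e13 e14]; have [_ _ ef] := rd.
rewrite (insubT (fun i => i < n) lt) -[eqtype.Sub i lt]/(Ordinal lt) /=;
  set i' := Ordinal lt.
step; apply: (@if_bitP C i') => // x y z.
rewrite /coef; case: ifP => iC; apply: (@write_termP _ j i') => //; step.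
- by move=> bs; rewrite e14 -expnSr exp_le.
- by rewrite e14 -expnSr ef.
- by move=> bs; rewrite e14 -expnSr exp_le.
- by rewrite e14 -expnSr.
Qed.

Lemma write_headP s j C T (Q : state F -> nat -> Prop) :
  mem s 9 = j -> mem s 10 = set_name C -> mem s 12 = j.+1 ->
  Q (State (mem s) (fmem s) (out s ++ nats F [:: 1; j; set_name C; j.+1])) T ->
  wp W write_head s T.+4 Q.
Proof.
move=> e9 e10 e12 q; rewrite /write_head; do 7 step.
by move: q; rewrite e9 e10 e12 /= -!cats1 -!catA.
Qed.

Definition flip_out j C (i : 'I_n) : seq (symb F) :=
  if #|flip C (Some i)| + j.+1 <= k then
    enc_edge code (move_edge F var (j, C) (Some i))
  else [::].

Lemma write_flipP j C p i s : C \in layer_sets n k j -> i < n ->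
  label_inv j C (#|C| + j + 1 + 1) p i s ->
  wp W (write_flip wvar) s 17 (fun s' _ =>
    [/\ mem s' 13 = i, label_inv j C (#|C| + j + 1 + 1) p i.+1 (set_reg s' 13 i.+1) &
        out s' = out s ++ oapp (flip_out j C) [::] (insub i)]).
Proof.
rewrite mem_layer_sets => /andP[Cj Ck] lt [[rd e9 e10 e11 [e12 e7]] e13 e14].
have [[_ e1 _ [e3 _ _]] _ ef] := rd.
rewrite (insubT (fun i => i < n) lt) -[eqtype.Sub i lt]/(Ordinal lt) /=;
  set i' := Ordinal lt.
step; apply: (@if_bitP C i') => // x y z.
rewrite /flip_out /flip; case: (boolP (i' \in C)) => iC.
  have cD : #|C :\ i'|.+1 = #|C| by rewrite [RHS](cardsD1 i') iC.
  (* Losing an element makes up for the step to the next layer, so the machine needs no test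
     here. *)
  have -> : #|C :\ i'| + j.+1 <= k by rewrite addnS -addSn cD.
  have jk : j < k by rewrite (leq_trans _ Ck) // -cD addSn ltnS leq_addl.
  do 2 step; first by move=> bs; rewrite (leq_trans (leq_subr _ _)) // (bs 10).
  do 2 step; first by move=> bs; rewrite (leq_trans (leq_subr _ _)) // (bs 17).
  step; apply: (@write_headP _ j C) => //=; do 2 step.
  apply: (@write_termP _ j i') => //; step.
    by move=> bs; rewrite e14 -expnSr exp_le.
  split=> //; first by rewrite e14 -expnSr.
  have nameE : set_name (C :\ i') = set_name C - 2 ^ n - 2 ^ i by rewrite set_nameD1.
  by rewrite e10 e3 e14 -nameE /enc_edge /= /coef /flip iC ef -!cats1 -!catA ?cats0.
step; rewrite e11 e1.
have -> : #|i' |: C| + j.+1 = #|C| + j + 1 + 1.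
  by rewrite cardsU1 iC !addn1 addnS -addnA add1n.
case: ifP => jk; last first.
  step; step; first by move=> bs; rewrite e14 -expnSr exp_le.
  by rewrite cats0 e14 -expnSr.
have {}jk : j < k by rewrite (leq_trans _ jk) // !addn1 ltnS ltnW // ltnS leq_addl.
do 2 step.
  move=> bs; rewrite e10 e3; apply: leq_trans (name_le (i' |: C)).
  by rewrite set_nameU1 // leq_addr.
do 2 step.
  move=> bs; rewrite e10 e3 e14; apply: leq_trans (name_le (i' |: C)).
  by rewrite set_nameU1.
step; apply: (@write_headP _ j C) => //=; do 2 step.
apply: (@write_termP _ j i') => //; step.
  by move=> bs; rewrite e14 -expnSr exp_le.
split=> //; first by rewrite e14 -expnSr.
have nameE : set_name (i' |: C) = set_name C + 2 ^ n + 2 ^ i by rewrite set_nameU1.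
rewrite e10 e3 e14 -nameE /enc_edge /= /coef /flip (negbTE iC).
by rewrite -!cats1 -!catA ?cats0.
Qed.

Definition edges_out x : seq (symb F) :=
  flatten [seq enc_edge code (move_edge F var x o) | o <- moves k x].

Lemma edges_outE j C :
  edges_out (j, C) =
    (if #|C| + j.+1 <= k then enc_edge code (move_edge F var (j, C) None)
     else [::]) ++
    flatten [seq flip_out j C i | i <- enum 'I_n].
Proof.
rewrite /edges_out /moves /=; set l := filter _ (map _ _).
have -> : flatten [seq flip_out j C i | i <- enum 'I_n] =
    flatten [seq enc_edge code (move_edge F var (j, C) o) | o <- l].
  rewrite /l; elim: (enum 'I_n) => //= i e ->.
  by rewrite {1}/flip_out; case: ifP.
by case: ifP.
Qed.

(** [write_stay] and [write_flip] take 9 and 17 units, and the loop rule adds 2 to each. *)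
Definition edges_time := ((n * 11 + 2).+4.+4 + (n * 19 + 2)).+4.

Lemma write_edgesP s j C : j <= k.-1 -> C \in layer_sets n k j ->
  ready (mem s) (fmem s) ->
  mem s 9 = j -> mem s 10 = set_name C -> mem s 11 = #|C| + j ->
  wp W (write_edges wvar) s edges_time.+1 (fun s' _ =>
    [/\ ready (mem s') (fmem s'), mem s' 9 = j,
        mem s' 7 = mem s 7 & out s' = out s ++ edges_out (j, C)]).
Proof.
move=> jk CL rd e9 e10 e11.
have {}jk : j < k by lia.
have := CL; rewrite mem_layer_sets => /andP[_ Ck].
have n1W : n.-1 < 2 ^ W by apply: small_le; lia.
have nE : n.-1.+1 - 0 = n by rewrite prednK ?subn0.
have cE : #|C| + j.+1 = #|C| + j + 1 by rewrite addn1 addnS.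
rewrite edges_outE cE; set A := if _ then _ else _.
rewrite /edges_time /write_edges; do 2 step.
  by move=> bs; rewrite e9; apply: small_le; lia.
do 2 step.
  by move=> bs; rewrite e11 -addnA; apply: card_le_width; lia.
rewrite e9 e11 (addn1 j); step.
(* An intermediate assertion with a fixed remaining time, so that both outcomes of the test for the
   keeping edge continue alike. *)
pose Q' s' (T : nat) := [/\ edge_inv j C (#|C| + j + 1) (mem s 7) s',
  out s' = out s ++ A & T = (n * 19 + 2).+3].
apply: (@wp_post _ _ _ _ Q') => [s' T' [[rd' e9' e10' e11' [e12' e7']] o' ->]|].
  do 2 step.
    by move=> bs; rewrite e11' -!addnA; apply: card_le_width; lia.
  do 2 step; first by move=> bs; apply: small_le; lia.
  rewrite e11' addn0; apply: (@wp_le _ _ _ ((n.-1.+1 - 0) * 19 + 2 + 0)).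
    by rewrite nE addn0 leqnSn.
  apply: (@wp_for_out _ _ _ _ _ _ _ 0 n.-1
    (label_inv j C (#|C| + j + 1 + 1) (mem s 7)) (fun i => oapp (flip_out j C) [::] (insub i))) => //.
  - by move=> i s1 [[[[_ _ _ [_ ? _]] _ _] _ _ _ _] ? _].
  - by move=> i s1 ii; apply: write_flipP => //; lia.
  move=> s1 [[rd1 e91 e101 e111 [e121 e71]] _ _]; rewrite nE flatten_ord /= => o1.
  by split=> //; rewrite o1 o' catA.
have [_ e1 _ [e3 _ _]] := let: And3 rg _ _ := rd in rg.
apply: (@wp_le _ _ _ ((n * 11 + 2).+4.+4 + (n * 19 + 2)).+2); first by lia.
have -> : ((n * 11 + 2).+4.+4 + (n * 19 + 2)).+2 =
   ((n.-1.+1 - 0) * 11 + 2 + (n * 19 + 2).+3).+4.+3.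
  by rewrite nE; lia.
step; rewrite e1; case: ifP => Cjk; last first.
  apply: (@wp_le _ _ _ (n * 19 + 2).+4); first by lia.
  by step; split=> //; rewrite /A (_ : _ <= k = false) ?cats0.
step; apply: (@write_headP _ j C) => //=; do 4 step.
  by move=> bs; apply: small_le; lia.
apply: (@wp_for_out _ _ _ _ _ _ _ 0 n.-1
  (label_inv j C (#|C| + j + 1) (mem s 7))
  (fun i => oapp (fun i => enc_term code (coef F C i, var j i)) [::] (insub i))) => //.
- by move=> i s1 [[[[_ _ _ [_ ? _]] _ _] _ _ _ _] ? _].
- by move=> i s1 ii; apply: write_stayP => //; lia.
move=> s1 [ei _ _]; rewrite nE flatten_ord /= => o1.
split=> //; rewrite o1 e10 /A (_ : _ <= k = true) // /enc_edge /= -!cats1 -!catA -map_comp.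
by [].
Qed.

(** The 10 in [nodes] is 3 units for [write_node], 5 for the instructions around it in [for_cells]
    and 2 for the loop. *)
Definition program_time :=
  let edges := k * (total * edges_time.+4.+4 + 2).+2 + 2 in
  let nodes := k.+1 * (total * 10 + 2).+2 + 2 in
  (n * 3 + 2 + (enum_time + 2 + (nodes + (edges + 0)).+4.+1).+3).+4.+1.

Lemma enc_flip_abp :
  enc_abp code (flip_abp F k var) =
  nats F [:: k; 0; 0; k; 0] ++
  flatten [seq nats F [:: 0; x.1; set_name x.2] | x <- cells n k k.+1] ++
  flatten [seq edges_out x | x <- cells n k k].
Proof.
rewrite /enc_abp /=; congr [:: _, _, _, _, _ & _ ++ _].
  by rewrite /nats map_flatten -!map_comp.
elim: (cells n k k) => //= x l <-.
by rewrite map_cat flatten_cat -map_comp.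
Qed.

Lemma programP : exists t s,
  [/\ exec (program wvar) (init F n k) t s,
      t <= program_time * (8 * W.+1) & out s = enc_abp code (flip_abp F k var)].
Proof.
have k1E : k.-1.+1 = k by rewrite prednK.
have bs : bounded W (init F n k).
  by move=> [|[|a]]; apply: small_le => /=; rewrite ?nth_nil; lia.
have wpP : wp W (program wvar) (init F n k) program_time
    (fun s _ => out s = enc_abp code (flip_abp F k var)); last first.
  have [t [s [T [e le _ o]]]] := wpP bs.
  by exists t, s; split=> //; apply: leq_trans le; apply: leq_addr.
rewrite /program /program_time; step; apply: prepP => s rg ef eo.
step; apply: enumerateP => // s1 rd o1; have [[_ e1 _ _] _ _] := rd.
do 10 step; step.
apply: (for_cellsP (h := k) (Tb := 2)
  (g := fun x => nats F [:: 0; x.1; set_name x.2])) => //.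
- by move=> s2 [[]].
- by move=> s2 j C _ _ rd2 e9 e10 _; apply: write_nodeP.
move=> s2 rd2; rewrite /= o1 e1 => o2.
rewrite -{1}k1E; apply: (for_cellsP (h := k.-1) (g := edges_out)) => //.
- exact: leq_pred.
- by move=> s3 [[_ _ _ []]].
- exact: write_edgesP.
by move=> s3 _; rewrite o2 k1E enc_flip_abp => ->; rewrite -catA.
Qed.

End Correctness.

(** * Polynomial bounds on time and size *)

Lemma Ostar_poly (q f : nat -> nat -> nat) a b :
  (forall n k, 0 < n -> 0 < k -> f n k <= a * (n + k) ^ b * q n k) -> Ostar q f.
Proof.
move=> H; exists (a + b) => n k n0 k0; apply: leq_trans (H n k n0 k0) _.
rewrite leq_mul2r leq_mul ?orbT ?leq_addr // leq_pexp2l ?leq_addl //.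
by rewrite addn_gt0 n0.
Qed.

Lemma binom_down_gt0 n r : 0 < binom_down n r.
Proof. by rewrite /binom_down big_nat_recl // bin0. Qed.

(** Once every monomial of the time and size bounds lies below the single quantity [z], these bounds
    become linear inequalities. *)
Lemma monomial_bounds n k q : 0 < n -> 0 < k -> 0 < q ->
  let z := (n + k) ^ 2 * q in
  [/\ 1 <= z, n <= z, k <= z & [/\ q <= z, n * q <= z, k * q <= z & k * q * n <= z]].
Proof.
move=> n0 k0 q0 z.
have le a b : a <= n + k -> b <= n + k -> a * b * q <= z.
  by move=> ha hb; rewrite /z -mulnn leq_mul // leq_mul.
have nk : n <= n + k by apply: leq_addr.
have kn : k <= n + k by apply: leq_addl.
have x0 : 1 <= n + k by lia.
have := (le 1 1 x0 x0, le n 1 nk x0, le k 1 kn x0, le k n kn nk).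
rewrite !muln1 mul1n mulnAC => -[[[h1 h2] h3] h4].
split; [by lia| | |split=> //]; [apply: leq_trans h2|apply: leq_trans h3];
  exact: leq_pmulr.
Qed.

Lemma Ostar_program_time :
  Ostar (fun n k => binom_down n (k %/ 2))
    (fun n k => program_time n k * (8 * (width n k).+1)).
Proof.
(* There are at most 200 z units of time. A unit costs at most 72 (n + k), since 8 (2n + k + 7) has
   leading coefficients at most 16 and constant 56; this raises the exponent from 2 to 3. *)
apply: (@Ostar_poly _ _ (200 * 72) 3) => n k n0 k0.
set q := binom_down _ _.
have q0 : 0 < q by apply: binom_down_gt0.
have [h1 h2 h3 [h4 h5 h6 h7]] := monomial_bounds n0 k0 q0.
have hT : program_time n k <= 200 * ((n + k) ^ 2 * q).
  rewrite /program_time /enum_time /edges_time -/q.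
  move: ((n + k) ^ 2 * q) h1 h2 h3 h4 h5 h6 h7 => z; lia.
have hW : 8 * (width n k).+1 <= 72 * (n + k) by rewrite /width; lia.
apply: leq_trans (leq_mul hT hW) _.
by rewrite mulnACA -[leqRHS]mulnA (expnSr _ 2) [_ * q * _]mulnAC.
Qed.

Lemma Ostar_size :
  Ostar (fun n k => binom_down n (k %/ 2))
    (fun n k => k.+1 * binom_down n (k %/ 2) + k * binom_down n (k %/ 2) * n.+1).
Proof.
apply: (@Ostar_poly _ _ 4 2) => n k n0 k0.
have := monomial_bounds n0 k0 (binom_down_gt0 n (k %/ 2)).
move: (binom_down _ _) => q /= [h1 h2 h3 [h4 h5 h6 h7]].
by rewrite -[leqRHS]mulnA; move: ((n + k) ^ 2 * q) h1 h2 h3 h4 h5 h6 h7 => z; lia.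
Qed.

(** * The two families *)

Lemma explicit_flip_abp (F : fieldType) (V : nat -> nat -> choiceType)
    (code : forall n k, V n k -> seq nat) (f : forall n k, ncpoly F (V n k))
    (wvar : cmd) :
  (forall n k, 0 < n -> 0 < k -> exists var : nat -> 'I_n -> V n k,
    f n k = (\sum_(w : k.-tuple 'I_n | uniq w) word_mon F var 0 w)%R /\
    (forall (s : state F) j (i : 'I_n) T Q, j < k -> mem s 9 = j -> mem s 13 = i ->
      Q (State (mem s) (fmem s) (out s ++ nats F (code n k (var j i)))) T ->
      wp (width n k) wvar s T.+2 Q)) ->
  explicit_ABPs code f (fun n k => binom_down n (k %/ 2)).
Proof.
(* [wvar] is fixed before [n] and [k], so a single program serves all inputs. *)
move=> H; exists (program wvar), (fun n k => program_time n k * (8 * (width n k).+1)).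
exists (fun n k => k.+1 * binom_down n (k %/ 2) + k * binom_down n (k %/ 2) * n.+1).
split; [exact: Ostar_program_time|exact: Ostar_size|move=> n k n0 k0].
have [var [fE wvarP]] := H n k n0 k0.
have [t [s [e le o]]] := programP n0 k0 wvarP.
exists (flip_abp F k var), t, s; split=> //.
- exact: flip_abp_wf.
- exact: size_flip_abp.
- by rewrite flip_abp_poly fE.
Qed.

Lemma word_monE (F : fieldType) (V : choiceType) n (var : nat -> 'I_n -> V) j k
    (w : k.-tuple 'I_n) :
  word_mon F var j w = (\prod_(i < k) ncvar F (var (j + i)%N (tnth w i)))%R.
Proof.
elim: k j w => [|k IH] j w; first by rewrite (tuple0 w) big_ord0.
case/tupleP: w => i w; rewrite big_ord_recl /= IH tnth0;
  congr (ncvar F (var _ _) * _)%R.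
  exact/esym/addn0.
by apply: eq_bigr => l _; rewrite tnthS /bump leq0n add1n addnS.
Qed.

Theorem theorem1 (F : fieldType) :
  explicit_ABPs (V := fun n k => 'I_n) code_vec (sym_star F)
    (fun n k => binom_down n (k %/ 2))
  /\
  explicit_ABPs (V := fun n k => ('I_k * 'I_n)%type) code_mat (rper F)
    (fun n k => binom_down n (k %/ 2)).
Proof.
split.
  apply: (@explicit_flip_abp _ (fun n k => 'I_n) _ _ (Write (reg 13))) => n k n0 k0.
  exists (fun _ i => i); split.
    apply: eq_bigr => w _; rewrite word_monE (big_tuple _ _ w xpredT).
    exact: eq_bigr.
  (* A single [Write] uses one of the two units allowed for printing a variable. *)
  move=> s j i T Q _ _ e13 q; apply: (@wp_le _ _ _ _ _ _ T.+1) => //.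
  apply: wp_write => //; first by rewrite /width; lia.
  by rewrite /= e13 -cats1.
apply: (@explicit_flip_abp _ (fun n k => ('I_k * 'I_n)%type) _ _
  (Write (reg 9) ;; Write (reg 13))) => n k n0 k0.
(* Layers are natural numbers but rows lie in ['I_k]; the default row is harmless because only
   layers below [k] occur. *)
exists (fun j i => (insubd (Ordinal k0) j, i)); split.
  (* A word of length [k] is a function on positions, and its letters are distinct exactly when the
     function is injective. *)
  rewrite /rper (reindex (fun w : k.-tuple 'I_n => [ffun i => tnth w i])) /=.
    apply: eq_big => [w|w _].
      transitivity (uniq (map (tnth w) (enum 'I_k))); last by rewrite map_tnth_enum.
      by congr uniq; apply: eq_map => i; rewrite ffunE.
    rewrite word_monE; apply: eq_bigr => i _.
    by rewrite ffunE add0n valKd.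
  exists (fun s : {ffun 'I_k -> 'I_n} => [tuple s i | i < k]) => [w _|s _].
    by apply: eq_from_tnth => i; rewrite tnth_mktuple ffunE.
  by apply/ffunP => i; rewrite ffunE tnth_mktuple.
move=> s j i T Q jk e9 e13 q; have W5 : 5 <= width n k by rewrite /width; lia.
apply: wp_seq => //; apply: wp_write => //; apply: wp_write => //=.
have jE : insubd (Ordinal k0) j = j :> nat by apply: (insubdK (Ordinal k0)).
by move: q; rewrite e9 e13 -!cats1 -catA /code_mat /= jE.
Qed.
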